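(* For each $n$ let $H_n$ be a uniformly random pair partition of $[2n]=\{1,\dots,2n\}$, let $Y_n$ be the number of crossings in $H_n$, and put $Z_n:=(Y_n-\mathbb{E}Y_n)/\sqrt{\mathbb{V}Y_n}$. Let $N$ be a standard normally distributed random variable. Then for every even $k$ there is a constant $C_1(k)$, not depending on $n$, such that for all $n\ge2$ $$\bigl|\mathbb{E}(Z_n^k)-\mathbb{E}(N^k)\bigr|\le C_1(k)\,\frac1n.$$
   Context: A pair partition of $[2n]$ is a set of disjoint 2-element subsets of $[2n]$ whose union is $[2n]$. A crossing in a pair partition $H$ is a quadruple $(i,j,k,l)$ with $i<j<k<l$ such that $\{i,k\}$ and $\{j,l\}$ belong to $H$. $\mathbb{V}$ denotes variance. *)

(* Defs.v *)
From mathcomp Require Import all_boot all_order all_algebra.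

Set Implicit Arguments.
Unset Strict Implicit.
Unset Printing Implicit Defensive.

(* The ground set {1, .., 2n} is represented by 'I_(2 * n) = {0, .., 2n - 1};
   the shift by one preserves the order, hence the crossings. *)
Definition pair_partition (n : nat) (H : {set {set 'I_(2 * n)}}) : bool :=
  partition H [set: 'I_(2 * n)] && [forall B in H, #|B| == 2].

Definition crossing (n : nat) (H : {set {set 'I_(2 * n)}})
    (q : 'I_(2 * n) * 'I_(2 * n) * 'I_(2 * n) * 'I_(2 * n)) : bool :=
  let: (i, j, k, l) := q in
  [&& i < j, j < k, k < l, [set i; k] \in H & [set j; l] \in H].

Definition crossings (n : nat) (H : {set {set 'I_(2 * n)}}) : nat :=
  #|[set q | crossing H q]|.

Definition num_pair_partitions (n : nat) : nat :=
  #|[set H : {set {set 'I_(2 * n)}} | pair_partition H]|.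

From mathcomp Require Import all_classical all_reals all_analysis.
Import Order.TTheory GRing.Theory Num.Theory.
Import numFieldNormedType.Exports.

Local Open Scope classical_set_scope.
Local Open Scope ring_scope.

(* Measurability of the fibres is measurability of H for the discrete
   sigma-algebra on its (finite) codomain. *)
Definition uniform_pair_partition (R : realType) (d : measure_display)
    (T : measurableType d) (P : probability T R) (n : nat)
    (H : T -> {set {set 'I_(2 * n)}}) : Prop :=
  (forall t, pair_partition (H t)) /\
  (forall p, pair_partition p ->
     measurable (H @^-1` [set p]) /\
     P (H @^-1` [set p]) = ((num_pair_partitions n)%:R^-1)%:E).

(* The two set functions are compared on measurable sets only: outside the
   sigma-algebra the values of [normal_prob] are meaningless. *)
Definition standard_normal (R : realType) (d : measure_display)
    (T : measurableType d) (P : probability T R) (N : {RV P >-> R}) : Prop :=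
  forall A : set R, measurable A -> distribution P N A = normal_prob 0 1 A.

Definition standardize (R : realType) (d : measure_display)
    (T : measurableType d) (P : probability T R) (Y : T -> R) : T -> R :=
  fun t => (Y t - fine 'E_P[Y]) / Num.sqrt (fine 'V_P[Y]).

(* Main.v *)
Require Import Defs.
From mathcomp Require Import all_boot all_order all_fingroup all_algebra.
From mathcomp Require Import zify ring lra.

(** Label the chords of the matching by [I = 'I_n] and let the positions of the
    [2 n] chord ends [I * bool] be a uniformly random permutation [s].  The
    matching is then uniform, and the number of crossings is a U-statistic: the
    sum over pairs of chords of the indicator that they cross.  The centred
    indicator [dev (i, j)] depends only on the relative order of four positions,
    and relative orders within disjoint sets of chords are independent.

    Let [T = total_dev] be the sum of all [dev e].  If [h] is centred and depends
    on the chords of [A] only, then [h] is independent of [T - near_dev A], the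
    part of [T] not involving [A]; expanding [(T - near_dev A) ^ j] therefore
    expresses [E (h T ^ j)] through [E (h (near_dev A) ^ i T ^ (j - i))] with
    [i >= 1].  By induction this gives [E (G T ^ j) = O (n ^ floor (3 j / 2))] for
    bounded [G] depending on boundedly many chords, and then, keeping the term
    [i = 1], [E T ^ (k + 2) = (k + 1) E (T ^ 2) E T ^ k + O (n ^ ((3 k + 5) / 2))].
    For even [k] the exponent is a full unit below that of the main term, because
    it is rounded down; since [E (T ^ 2)] is of order [n ^ 3], the normalised even
    moments satisfy the recursion of the Gaussian moments up to [O (1 / n)]. *)

Set Implicit Arguments.
Unset Strict Implicit.
Unset Printing Implicit Defensive.
Import Order.TTheory GRing.Theory Num.Theory.

(** * Relative orders of a random permutation *)

(** Each entry of [p] goes to the entry of [q] at the same index. As [q] rearranges [p], this map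
    preserves membership in [p], so it stays injective when glued to the identity elsewhere. *)
Lemma perm_of_perm_eq (T : finType) (p q : seq T) :
  uniq p -> perm_eq p q ->
  exists2 r : {perm T}, map r p = q & forall x, x \notin p -> r x = x.
Proof.
move=> up pq; have uq : uniq q by rewrite -(perm_uniq pq).
have sz := perm_size pq; have mpq := perm_mem pq.
pose f x := if x \in p then nth x q (index x p) else x.
have fin x : (f x \in p) = (x \in p).
  rewrite /f; case: ifP => // xp; rewrite mpq mem_nth // -sz index_mem //.
have f_inj : injective f.
  move=> x y fxy; have := fin x; rewrite fxy fin => xyp.
  move: fxy; rewrite /f xyp; case: ifP => // xp.
  have yp : y \in p by rewrite xyp.
  rewrite (@set_nth_default _ q y x) -?sz ?index_mem // => /eqP.
  rewrite nth_uniq -?sz ?index_mem // => /eqP/(congr1 (nth x p)).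
  by rewrite !nth_index.
exists (perm f_inj) => [|x xp]; last by rewrite permE /f (negbTE xp).
case: p up pq sz mpq @f fin f_inj => [|x0 p] up pq sz mpq f fin f_inj.
  by move: pq; rewrite perm_sym => /perm_nilP ->.
apply: (@eq_from_nth _ x0); rewrite size_map // => i ip.
rewrite (nth_map x0) // permE /f mem_nth // index_uniq //.
by apply: set_nth_default; rewrite -sz.
Qed.

(* [c] lies between [a] and [b] iff exactly one of [a < c] and [b < c] holds. *)
Definition cross (a b c d : nat) : bool :=
  ((a < c) (+) (b < c)) (+) ((a < d) (+) (b < d)).

(** Exchanging the chords negates all four comparisons, and four negations cancel in an exclusive
    or. *)
Lemma crossC a b c d : uniq [:: a; b; c; d] -> cross a b c d = cross c d a b.
Proof.
rewrite /= !inE !negb_or => /and4P [/and3P[ab ac ad] /andP[bc bd] _ _].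
rewrite /cross.
have H x y : x != y -> (y < x) = ~~ (x < y) by move=> ?; lia.
rewrite (H a c) // (H b c) // (H a d) // (H b d) //.
by do 4!case: (_ < _).
Qed.

Section Chords.
Variables (R : realFieldType) (I : finType).
Local Open Scope ring_scope.
Local Notation J := (I * bool)%type.
Implicit Types (A B : {set I}) (F G : {perm J} -> R) (s t : {perm J}).

(** Chord ends are permuted among themselves and only then ranked, so that the sample space is a
    group and multiplication preserves the uniform law. *)
Definition pos s (x : J) : nat := enum_rank (s x).

Definition mean F : R := (\sum_s F s) / #|{perm J}|%:R.

Definition same_order A s t := forall x y : J, x.1 \in A -> y.1 \in A ->
  (pos s x < pos s y)%N = (pos t x < pos t y)%N.

(** Relative orders are used instead of positions because the positions of disjoint sets of chords
    are dependent, while their relative orders are not. *)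
Definition local A F := forall s t, same_order A s t -> F s = F t.

Lemma pos_inj s : injective (pos s).
Proof. by move=> x y /val_inj/enum_rank_inj/perm_inj. Qed.

Lemma card_perm_neq0 : #|{perm J}|%:R != 0 :> R.
Proof. by rewrite pnatr_eq0 -lt0n; apply/card_gt0P; exists 1%g. Qed.

Lemma meanD F G : mean (fun s => F s + G s) = mean F + mean G.
Proof. by rewrite /mean big_split mulrDl. Qed.

Lemma mean_sum (K : Type) (r : seq K) (P : pred K) (F : K -> {perm J} -> R) :
  mean (fun s => \sum_(k <- r | P k) F k s) = \sum_(k <- r | P k) mean (F k).
Proof. by rewrite /mean exchange_big /= mulr_suml. Qed.

Lemma meanZ c F : mean (fun s => c * F s) = c * mean F.
Proof. by rewrite /mean -mulr_sumr mulrA. Qed.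

Lemma meanN F : mean (fun s => - F s) = - mean F.
Proof. by rewrite /mean sumrN mulNr. Qed.

Lemma meanB F G : mean (fun s => F s - G s) = mean F - mean G.
Proof. by rewrite meanD meanN. Qed.

Lemma mean_cst c : mean (fun=> c) = c.
Proof.
rewrite /mean big_const iter_addr addr0 -(mulr_natr c) mulfK //.
exact: card_perm_neq0.
Qed.

Lemma eq_mean F G : F =1 G -> mean F = mean G.
Proof. by move=> FG; rewrite /mean (eq_bigr G). Qed.

Lemma norm_mean_le F K : (forall s, `|F s| <= K) -> `|mean F| <= K.
Proof.
move=> FK; rewrite -[leRHS](mean_cst K) /mean normrM normfV normr_nat.
apply: ler_wpM2r; first by rewrite invr_ge0.
by apply: le_trans (ler_norm_sum _ _ _) _; apply: ler_sum.
Qed.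

Lemma mean_ge0 F : (forall s, 0 <= F s) -> 0 <= mean F.
Proof. by move=> F0; rewrite divr_ge0 ?sumr_ge0. Qed.

Lemma mean_mulg r F : mean (fun s => F (r * s)%g) = mean F.
Proof.
by rewrite /mean; congr (_ / _); rewrite [RHS](reindex_inj (mulgI r)).
Qed.

Lemma posM r s x : pos (r * s)%g x = pos s (r x).
Proof. by rewrite /pos permM. Qed.

Lemma localS A B F : A \subset B -> local A F -> local B F.
Proof.
move=> /subsetP AB lF s t st; apply: lF => x y xA yA.
by apply: st; apply: AB.
Qed.

Lemma local_cst A c : local A (fun=> c). Proof. by []. Qed.

Lemma localD A F G : local A F -> local A G -> local A (fun s => F s + G s).
Proof. by move=> lF lG s t st; rewrite (lF s t) // (lG s t). Qed.

Lemma localN A F : local A F -> local A (fun s => - F s).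
Proof. by move=> lF s t st; rewrite (lF s t). Qed.

Lemma localM A F G : local A F -> local A G -> local A (fun s => F s * G s).
Proof. by move=> lF lG s t st; rewrite (lF s t) // (lG s t). Qed.

Lemma localX A F k : local A F -> local A (fun s => F s ^+ k).
Proof. by move=> lF s t st; rewrite (lF s t). Qed.

(** List the ends of the chords of [A] by increasing position, once for [s] and once for [t]; [r]
    carries the second list to the first, entry by entry. *)
Lemma same_order_perm A s t :
  exists2 r : {perm J}, same_order A (r * s)%g t & perm_on [set x | x.1 \in A] r.
Proof.
pose D := [set x : J | x.1 \in A].
pose le u (x y : J) := (pos u x <= pos u y)%N.
have le_tr u : transitive (le u) by move=> x y z; apply: leq_trans.
have le_tot u : total (le u) by move=> x y; apply: leq_total.
pose L u := sort (le u) (enum D).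
have ltL u : sorted (fun x y => pos u x < pos u y)%N (L u).
  have := sort_sorted (le_tot u) (enum D).
  have: uniq (L u) by rewrite sort_uniq enum_uniq.
  rewrite -/(L u) !(sorted_pairwise) //; last first.
  - by move=> x y z /=; apply: ltn_trans.
  rewrite uniq_pairwise => un le_.
  apply: sub_pairwise (_ : pairwise [rel x y | (x != y) && le u x y] _).
    move=> x y /andP[xy]; rewrite /le leq_eqVlt => /orP[/eqP/pos_inj/eqP|//].
    by rewrite (negbTE xy).
  by rewrite pairwise_relI un.
have memL u x : (x \in L u) = (x.1 \in A) by rewrite mem_sort mem_enum inE.
have ltE u x y : x \in L u -> y \in L u ->
    (pos u x < pos u y)%N = (index x (L u) < index y (L u))%N.
  move=> xL yL; apply/idP/idP => [|lt_]; last first.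
    have := sorted_ltn_index (fun x y z => @ltn_trans (pos u x) (pos u y) (pos u z)) (ltL u).
    by move=> /(_ x y xL yL lt_).
  apply: contraTT; rewrite -!leqNgt leq_eqVlt => /orP[/eqP ixy|lt_].
    have -> // : x = y.
    by rewrite -(nth_index x xL) -(nth_index x yL) ixy.
  apply: ltnW; have := sorted_ltn_index (fun x y z => @ltn_trans (pos u x) (pos u y) (pos u z)) (ltL u).
  by move=> /(_ y x yL xL lt_).
have uL u : uniq (L u) by rewrite sort_uniq enum_uniq.
have pL : perm_eq (L t) (L s).
  by rewrite perm_sort perm_sym perm_sort.
have [r rL r_out] := perm_of_perm_eq (uL t) pL.
have r_ix x : x \in L t -> index (r x) (L s) = index x (L t).
  by move=> xL; rewrite -rL index_map //; apply: perm_inj.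
exists r => [x y xA yA|]; last first.
  apply/subsetP => x; rewrite !inE; apply: contraNT => xA.
  by apply/eqP/r_out; rewrite memL.
rewrite !posM !ltE ?r_ix ?memL //; rewrite -(memL s) -rL map_f ?memL //.
Qed.

(** Average over left multiplication by the group [S] of permutations supported on the ends of [A].
    These fix the ends of [B], so [G] does not change, while by [same_order_perm] the average of [F]
    over an [S]-orbit is the same for every orbit. *)
Theorem mean_indep A B F G :
  [disjoint A & B] -> local A F -> local B G ->
  mean (fun s => F s * G s) = mean F * mean G.
Proof.
move=> dAB lF lG; pose D := [set x : J | x.1 \in A].
pose S : {set {perm J}} := [set r | perm_on D r].
have S1 : (1%g : {perm J}) \in S by rewrite inE perm_on1.
have S0 : #|S|%:R != 0 :> R by rewrite pnatr_eq0 -lt0n; apply/card_gt0P; exists 1%g.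
have inD r x : r \in S -> ((r x).1 \in A) = (x.1 \in A).
  by rewrite inE => rD; have := perm_closed x rD; rewrite !inE.
pose K s := \sum_(r in S) F (r * s)%g.
have Kcst s t : K s = K t.
  have [u us uD] := same_order_perm A s t.
  have uS : u \in S by rewrite inE.
  (* Translating the summation index by [u] replaces [s] by [u * s], which orders the ends of [A] as
     [t] does. *)
  have SM r : ((r * u)%g \in S) = (r \in S).
    apply/idP/idP; rewrite !inE => h; last exact: perm_onM.
    by rewrite -(mulgK u r) perm_onM ?perm_onV.
  rewrite /K (reindex_inj (mulIg u)) /=; apply: eq_big => // r.
  rewrite SM => rS; apply: lF => x y xA yA; rewrite -mulgA !(posM r).
  by apply: us; rewrite inD.
have key G' : local B G' -> mean (fun s => F s * G' s) = K 1%g / #|S|%:R * mean G'.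
  move=> lG'; rewrite -meanZ.
  transitivity (mean (fun s => K s / #|S|%:R * G' s)); last first.
    by apply: eq_mean => s; rewrite (Kcst s 1%g).
  transitivity (mean (fun s => #|S|%:R^-1 * \sum_(r in S) F (r * s)%g * G' (r * s)%g)).
    rewrite meanZ mean_sum.
    under eq_bigr => r rS do rewrite (mean_mulg r (fun s => F s * G' s)).
    by rewrite sumr_const -[X in _ = _ * X]mulr_natl mulKf.
  apply: eq_mean => s; rewrite /K mulrAC mulr_suml mulrC; congr (_ * _).
  apply: eq_bigr => r rS; congr (_ * _); apply: lG' => x y xB yB.
  have out z : z.1 \in B -> r z = z.
    move=> zB; move: rS; rewrite inE => /out_perm; apply; rewrite inE.
    by rewrite (disjointFl dAB).
  by rewrite !posM !out.
rewrite key //; congr (_ * _).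
(* The constant function 1 in place of [G] identifies the orbit average with [mean F]. *)
have := key (fun=> 1) (local_cst 1); rewrite mean_cst mulr1 => <-.
by apply: eq_mean => s; rewrite mulr1.
Qed.

(** This turns the mean of a function of the relative order of [k] ends into a finite computation.
    Relabelling the ends by any [v] in [T] preserves the mean, and the sum over [T] of the
    relabelled functions is the constant [c]. When [phi] has symmetries, [T] can be much smaller
    than the symmetric group. *)
Lemma mean_pattern (k : nat) (phi : seq nat -> nat) (T : seq (seq nat)) (c : nat) (p : seq J) :
  (forall x y, size x = k -> size y = k ->
    (forall i j, i < k -> j < k ->
      (nth 0 x i < nth 0 x j) = (nth 0 y i < nth 0 y j))%N -> phi x = phi y) ->
  all (perm_eq (iota 0 k)) T ->
  all (fun u => sumn [seq phi (map (nth 0%N u) v) | v <- T] == c)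
      (permutations (iota 0 k)) ->
  (0 < k)%N -> uniq p -> size p = k ->
  (size T)%:R * mean (fun s => (phi (map (pos s) p))%:R) = c%:R.
Proof.
move=> phi_inv /allP Tperm /allP check k_gt0 up szp.
case: p up szp => [|x0 p'] up szp; first by move: k_gt0; rewrite -szp.
set p := x0 :: p' in up szp *.
transitivity (mean (fun s => \sum_(v <- T) (phi (map (pos s) (map (nth x0 p) v)))%:R)).
  rewrite mean_sum -[size T]sum1_size natr_sum mulr_suml.
  apply: eq_big_seq => v /Tperm pt; rewrite mul1r.
  have pp : perm_eq p (map (nth x0 p) v).
    rewrite perm_sym -[X in perm_eq _ X](mkseq_nth x0) szp /mkseq.
    by rewrite perm_map // perm_sym.
  have [r rp _] := perm_of_perm_eq up pp.
  rewrite -(mean_mulg r); apply: eq_mean => s; congr (phi _)%:R.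
  by rewrite -rp -map_comp; apply: eq_map => x /=; rewrite posM.
rewrite -[RHS](mean_cst c%:R); apply: eq_mean => s.
pose x := map (pos s) p.
have ux : uniq x by rewrite map_inj_uniq //; apply: pos_inj.
(* The ranks of the positions: a permutation of [iota 0 k] with the same relative order, to which
   the computed check applies. *)
pose u := [seq count (fun b => b < a)%N x | a <- x].
have szx : size x = k by rewrite size_map.
have lt_count a b : a \in x -> b \in x ->
    (a < b)%N = (count (fun c => c < a)%N x < count (fun c => c < b)%N x)%N.
  have mono a' b' : (a' <= b')%N ->
     (count (fun c => c < a')%N x <= count (fun c => c < b')%N x)%N.
    by move=> ab; apply: sub_count => z /= ?; lia.
  move=> ax bx; case: ltnP => [ab|/mono]; last by rewrite leqNgt => /negbTE ->.
  symmetry; have: (count (fun c => c < a)%N x + 1 <= count (fun c => c < b)%N x)%N.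
    have h1: (1 <= count (pred1 a) x)%N by rewrite -has_count has_pred1.
    apply: leq_trans (leq_add (leqnn _) h1) _.
    rewrite -count_predUI [X in (_ + X)%N](_ : _ = 0%N) ?addn0; last first.
      apply/eqP; rewrite -leqn0 leqNgt -has_count.
      by apply/hasP => -[z _ /= /andP[za /eqP zE]]; lia.
    by apply: sub_count => z /= /orP[?|/eqP ->] //; lia.
  lia.
have uu : uniq u.
  rewrite map_inj_in_uniq // => a b ax bx ab.
  have := lt_count a b ax bx; have := lt_count b a bx ax; rewrite ab ltnn.
  by lia.
have pu : perm_eq u (iota 0 k).
  apply: uniq_perm => //; first exact: iota_uniq.
  have sub : {subset u <= iota 0 k}.
    move=> m /mapP[a ax ->]; rewrite mem_iota leq0n andTb add0n -szx.
    rewrite -(count_predC (fun c => c < a)%N x) -addn1 leq_add2l.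
    by rewrite -has_count; apply/hasP; exists a => //=; rewrite ltnn.
  by apply: (uniq_min_size uu sub _).2; rewrite size_iota size_map szx.
have := check u; rewrite mem_permutations => /(_ pu)/eqP <-.
rewrite sumnE big_map natr_sum; apply: eq_big_seq => v /Tperm pt.
have szt : size v = k by rewrite -(perm_size pt) size_iota.
have tk i : (i < k)%N -> (nth 0%N v i < k)%N.
  move=> ik; have := mem_nth 0%N; move=> /(_ v i); rewrite szt => /(_ ik).
  by rewrite -(perm_mem pt) mem_iota.
congr (_%:R); apply: phi_inv; rewrite ?size_map // => i j ik jk.
have step a : (a < k)%N -> nth 0%N (map (pos s) (map (nth x0 p) v)) a = nth 0%N x (nth 0%N v a).
  move=> ak; rewrite (nth_map x0) ?size_map ?szt // (nth_map 0%N) ?szt //.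
  by rewrite /x (nth_map x0) // szp tk.
rewrite !step // !(nth_map 0%N) ?szt ?szx ?tk //.
by rewrite -lt_count // mem_nth // szx tk.
Qed.

End Chords.

(** * Crossings as a U-statistic *)

Section CrossingStatistic.
Variables (R : realFieldType) (I : finType).
Local Open Scope ring_scope.
Local Notation J := (I * bool)%type.
Implicit Types (e : I * I) (s : {perm J}) (A : {set I}).

Definition crossi e s : bool :=
  cross (pos s (e.1, false)) (pos s (e.1, true))
        (pos s (e.2, false)) (pos s (e.2, true)).

(** Two distinct chords cross with probability 1/3, see [mean_crossi]. The value 0 on the diagonal
    lets sums run over all ordered pairs. *)
Definition dev e s : R := if e.1 == e.2 then 0 else (crossi e s)%:R - 1 / 3.

(* The sum runs over ordered pairs, so this is twice the centred number of
   crossings; the factor disappears on standardising. *)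
Definition total_dev s : R := \sum_e dev e s.

Definition ends e : {set I} := [set e.1; e.2].

Lemma local_dev e : local (ends e) (dev e).
Proof.
move=> s t st; rewrite /dev; case: eqP => // _; rewrite /crossi /cross.
by rewrite !st // !inE /= eqxx ?orbT.
Qed.

Lemma norm_dev e s : `|dev e s| <= 2 / 3.
Proof.
rewrite /dev; case: eqP => _; first by rewrite normr0; lra.
by case: crossi; rewrite ler_norml; apply/andP; split; rewrite ?mulr0n ?mulr1n; lra.
Qed.

Lemma sqr_dev_ge e s : e.1 != e.2 -> 1 / 9 <= dev e s * dev e s.
Proof. by rewrite /dev => /negbTE ->; case: crossi => /=; rewrite ?mulr0n ?mulr1n; nra. Qed.

Lemma dev_sym i j s : dev (i, j) s = dev (j, i) s.
Proof.
rewrite /dev /= eq_sym; case: eqP => // /eqP ji; congr (_%:R - _).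
congr nat_of_bool; apply: crossC; rewrite /= !inE !negb_or.
by rewrite !(inj_eq (@pos_inj _ s)) !xpair_eqE /= !andbT !andbF eq_sym ji.
Qed.

Lemma mean_crossi i j : i != j -> mean (fun s => (crossi (i, j) s)%:R) = 1 / 3 :> R.
Proof.
move=> ij; pose phi x := nat_of_bool
  (cross (nth 0 x 0) (nth 0 x 1) (nth 0 x 2) (nth 0 x 3))%N.
pose p := [:: (i, false); (i, true); (j, false); (j, true)].
(* One of the three pairings of four places crosses, hence 8 of the 24 orders. *)
have : 24%:R * mean (fun s => (phi (map (pos s) p))%:R) = 8%:R :> R.
  apply: (@mean_pattern R I 4 phi (permutations (iota 0 4))).
  - by move=> x y _ _ xy; rewrite /phi /cross !xy.
  - by vm_compute.
  - by vm_compute.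
  - by [].
  - by rewrite /= !inE !xpair_eqE /= !andbF !andbT !orbF (negbTE ij).
  - by [].
rewrite (_ : mean _ = mean (fun s => (crossi (i, j) s)%:R)) //.
by move: (mean _) => z; lra.
Qed.

Lemma mean_dev e : mean (dev e) = 0.
Proof.
case: e => i j; rewrite /dev /=; case: eqP => [_|/eqP ij]; first exact: mean_cst.
by rewrite meanB mean_cst mean_crossi // subrr.
Qed.

Lemma mean_crossi2 i j k : i != j -> i != k -> j != k ->
  mean (fun s => (crossi (i, j) s)%:R * (crossi (i, k) s)%:R) = 2 / 15 :> R.
Proof.
move=> ij ik jk; pose phi x :=
  (cross (nth 0 x 0) (nth 0 x 1) (nth 0 x 2) (nth 0 x 3) *
   cross (nth 0 x 0) (nth 0 x 1) (nth 0 x 4) (nth 0 x 5))%N.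
(* [phi] is symmetric within each chord, so one representative of each pair of
   orientations is enough: 90 relabellings instead of 720. *)
pose T := [seq t <- permutations (iota 0 6) |
  [&& nth 0 t 0 < nth 0 t 1, nth 0 t 2 < nth 0 t 3 & nth 0 t 4 < nth 0 t 5]]%N.
pose p := [:: (i, false); (i, true); (j, false); (j, true); (k, false); (k, true)].
(* There are 15 matchings of six places, each with 6 numberings of its chords. The one with three
   crossings counts for all 6 numberings, each of the three with two crossings for the 2 that make
   [i] the middle chord: 12 out of 90. *)
have : 90%:R * mean (fun s => (phi (map (pos s) p))%:R) = 12%:R :> R.
  rewrite (_ : 90%N = size T); last by vm_compute.
  apply: (@mean_pattern R I 6 phi).
  - by move=> x y _ _ xy; rewrite /phi /cross !xy.
  - by vm_compute.
  - by vm_compute.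
  - by [].
  - rewrite /= !inE !xpair_eqE /= !andbF !andbT !orbF.
    by rewrite (negbTE ij) (negbTE ik) (negbTE jk).
  - by [].
rewrite (@eq_mean _ _ _
  (fun s => (crossi (i, j) s)%:R * (crossi (i, k) s)%:R)); last first.
  by move=> s; rewrite -natrM.
by move: (mean _) => z; lra.
Qed.

(** For three distinct chords the covariance is exactly 2/15 - 1/9 = 1/45; for [j = k] the integrand
    is a square of size at least 1/9. *)
Lemma cov_dev_share i j k : i != j -> i != k ->
  1 / 45 <= mean (fun s => dev (i, j) s * dev (i, k) s).
Proof.
move=> ij ik; have [->|jk] := eqVneq j k.
  rewrite -[leLHS](@mean_cst R I) -subr_ge0 -meanB; apply: mean_ge0 => s.
  by have := @sqr_dev_ge (i, k) s ik; lra.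
rewrite (@eq_mean _ _ _ (fun s => (crossi (i, j) s)%:R * (crossi (i, k) s)%:R
   - (1 / 3 * (crossi (i, j) s)%:R + 1 / 3 * (crossi (i, k) s)%:R - 1 / 9))).
  rewrite meanB mean_crossi2 // meanB meanD !meanZ !mean_crossi // mean_cst.
  lra.
by move=> s; rewrite /dev /= (negbTE ij) (negbTE ik); lra.
Qed.

Lemma cov_dev_disjoint e e' : [disjoint ends e & ends e'] ->
  mean (fun s => dev e s * dev e' s) = 0.
Proof.
move=> dis; rewrite (mean_indep dis) ?mean_dev ?mul0r //; exact: local_dev.
Qed.

(** Pairs with a common chord reduce to [cov_dev_share] by symmetry, and disjoint pairs are
    uncorrelated. Nonnegativity allows terms to be dropped when the variance is bounded below. *)
Lemma cov_dev_ge0 e e' : 0 <= mean (fun s => dev e s * dev e' s).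
Proof.
case: e e' => i j [k l].
have g0 a b c d : a == b -> 0 <= mean (fun s => dev (a, b) s * dev (c, d) s).
  by move=> ab; rewrite /dev /= ab mean_ge0 // => s; rewrite mul0r.
have [ij|ij] := boolP (i == j); first exact: g0.
have [kl|kl] := boolP (k == l).
  rewrite (eq_mean (G := fun s => dev (k, l) s * dev (i, j) s)) ?g0 // => s.
  by rewrite mulrC.
have share a b c : a != b -> a != c -> 0 <= mean (fun s => dev (a, b) s * dev (a, c) s).
  by move=> ab ac; apply: le_trans (cov_dev_share ab ac); lra.
have [ik|ik] := eqVneq i k.
  by rewrite -ik in kl *; apply: share.
have [il|il] := eqVneq i l.
  rewrite -il in kl *.
  under eq_mean do rewrite (dev_sym k i).
  by apply: share => //; rewrite eq_sym.
have [jk|jk] := eqVneq j k.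
  rewrite -jk in kl *.
  under eq_mean do rewrite (dev_sym i j).
  by apply: share => //; rewrite eq_sym.
have [jl|jl] := eqVneq j l.
  rewrite -jl in kl *.
  under eq_mean do rewrite (dev_sym i j) (dev_sym k j).
  by apply: share; rewrite eq_sym.
rewrite cov_dev_disjoint //; apply/pred0P => x /=; rewrite !inE /=.
have [->|_] /= := eqVneq x i; first by rewrite (negbTE ik) (negbTE il).
by have [->|//] /= := eqVneq x j; rewrite (negbTE jk) (negbTE jl).
Qed.

Definition sigma2 : R := mean (fun s => total_dev s ^+ 2).

(** Only the covariances of [(i, j)] with [(i, k)], where [j] and [k] differ from [i], are kept;
    each is at least 1/45. *)
Lemma sigma2_ge : #|I|%:R * #|I|.-1%:R ^+ 2 / 45 <= sigma2.
Proof.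
rewrite /sigma2.
rewrite (@eq_mean _ _ _ (fun s => \sum_e \sum_e' dev e s * dev e' s)); last first.
  by move=> s; rewrite expr2 /total_dev mulr_suml; apply: eq_bigr => e _; rewrite mulr_sumr.
rewrite mean_sum -(pair_bigA _ (fun i j => mean (fun s => \sum_e' dev (i, j) s * dev e' s))) /=.
pose c (i j k : I) : R := ((j != i) && (k != i))%:R / 45.
have -> : #|I|%:R * #|I|.-1%:R ^+ 2 / 45 = \sum_i \sum_j \sum_k c i j k.
  rewrite -[in LHS]mulrA -{1}sum1_card natr_sum mulr_suml; apply: eq_bigr => i _.
  have cardN : #|I|.-1%:R = \sum_j (j != i)%:R :> R.
    by rewrite -natr_sum -big_mkcond sum1_card cardC1.
  rewrite mul1r cardN expr2 !mulr_suml; apply: eq_bigr => j _.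
  rewrite mulr_sumr mulr_suml; apply: eq_bigr => k _.
  by rewrite -natrM mulnb.
apply: ler_sum => i _; apply: ler_sum => j _.
rewrite mean_sum -(pair_bigA _ (fun a b => mean (fun s => dev (i, j) s * dev (a, b) s))) /=.
rewrite [leRHS](bigD1 i) //= -[leLHS]addr0 lerD //; last first.
  by do 2!(apply: sumr_ge0 => ? _); apply: cov_dev_ge0.
apply: ler_sum => k _; rewrite /c.
case: andP => [[ji ki]|_]; last by rewrite mul0r; apply: cov_dev_ge0.
by apply: cov_dev_share; rewrite eq_sym.
Qed.

End CrossingStatistic.

(** * Moments *)

Section MomentBounds.
Variable R : realFieldType.
Local Open Scope ring_scope.
Local Notation dev := (dev R).
Local Notation total_dev := (total_dev R).

Definition touches (I : finType) (A : {set I}) (e : I * I) :=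
  (e.1 \in A) || (e.2 \in A).

Definition near_dev (I : finType) (A : {set I}) s : R := \sum_(e | touches A e) dev e s.

Lemma local_total_devB (I : finType) (A : {set I}) :
  local (~: A) (fun s => total_dev s - near_dev A s).
Proof.
have WV s : total_dev s - near_dev A s = \sum_(e | ~~ touches A e) dev e s.
  by rewrite /total_dev (bigID (touches A)) /= addrC addrK.
move=> s t st; rewrite !WV; apply: eq_bigr => -[i j]; rewrite /touches negb_or /=.
case/andP=> iA jA; apply: local_dev => x y /= xe ye; apply: st; rewrite !inE in xe ye *.
  by case/orP: xe => /eqP ->.
by case/orP: ye => /eqP ->.
Qed.

Lemma sum_touches_le (I : finType) (A : {set I}) (F : I * I -> R) K :
  (forall e, touches A e -> F e <= K) ->
  0 <= K -> \sum_(e | touches A e) F e <= (2 * #|A| * #|I|)%:R * K.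
Proof.
move=> FK K0; apply: le_trans (ler_sum _ FK) _.
rewrite sumr_const -(mulr_natl K); apply: ler_wpM2r; rewrite // ler_nat.
have -> : #|touches A| = #|setX A setT :|: setX setT A|.
  by apply: eq_card => -[i j]; rewrite !inE /= andbT.
apply: leq_trans (leq_card_setU _ _) _.
by rewrite !cardsX cardsT; lia.
Qed.

Lemma sum_pairs_le (I : finType) (P : pred (I * I)) (F : I * I -> R) K :
  (forall e, P e -> F e <= K) -> 0 <= K ->
  \sum_(e | P e) F e <= #|I|%:R ^+ 2 * K.
Proof.
move=> FK K0; apply: le_trans (ler_sum _ FK) _.
rewrite sumr_const -(mulr_natl K); apply: ler_wpM2r; rewrite // -natrX ler_nat.
by rewrite -mulnn -card_prod max_card.
Qed.

Lemma norm_mulr_le1 (x y : R) : `|x| <= 1 -> `|y| <= 1 -> `|x * y| <= 1.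
Proof. by move=> x1 y1; rewrite normrM mulr_ile1. Qed.

Lemma norm_dev1 (I : finType) (e : I * I) s : `|dev e s| <= 1.
Proof. by apply: le_trans (norm_dev _ _ _) _; lra. Qed.

Lemma card_ends (I : finType) (e : I * I) : (#|ends e| <= 2)%N.
Proof. by rewrite cards2; case: eqP. Qed.

Lemma touches_disjoint (I : finType) (A : {set I}) e :
  ~~ touches A e -> [disjoint ends e & A].
Proof.
case: e => i j; rewrite /touches /= negb_or => /andP[iA jA].
apply/pred0P => x /=; rewrite !inE /=.
by apply/negP => /andP[/orP[/eqP->|/eqP->]]; apply/negP.
Qed.

(** Each factor [near_dev A] is a sum over at most [2 * #|A| * #|I|] pairs. The deviation of a pair
    is absorbed into [G], whose support grows by at most two chords; hence the budget
    [#|B| + 2 * i]. *)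
Lemma mean_near_dev_le (I : finType) (A : {set I}) (j s : nat) (K : R) : 0 <= K ->
  (forall (B : {set I}) (G : {perm I * bool} -> R), (#|B| <= s)%N -> local B G ->
     (forall u, `|G u| <= 1) -> `|mean (fun u => G u * total_dev u ^+ j)| <= K) ->
  forall i (B : {set I}) (G : {perm I * bool} -> R), (#|B| + 2 * i <= s)%N -> local B G ->
     (forall u, `|G u| <= 1) ->
  `|mean (fun u => G u * near_dev A u ^+ i * total_dev u ^+ j)| <=
    (2 * #|A| * #|I|)%:R ^+ i * K.
Proof.
move=> K0 H; elim=> [|i IH] B G sB lG G1.
  rewrite expr0 mul1r (@eq_mean _ _ _ (fun u => G u * total_dev u ^+ j)).
    by apply: H lG G1; lia.
  by move=> u; rewrite expr0 mulr1.
rewrite (@eq_mean _ _ _ (fun u =>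
  \sum_(e | touches A e) G u * dev e u * near_dev A u ^+ i * total_dev u ^+ j)); last first.
  by move=> u; rewrite exprS {1}/near_dev !(mulr_suml, mulr_sumr); apply: eq_bigr => e _; ring.
rewrite mean_sum; apply: le_trans (ler_norm_sum _ _ _) _.
rewrite exprS -mulrA; apply: sum_touches_le => [e _|]; last first.
  by rewrite mulr_ge0 ?exprn_ge0.
apply: (IH (B :|: ends e)).
- have := cardsU B (ends e); have := card_ends e.
  by move: (#|_ :|: _|) => x; lia.
- apply: localM; first exact: localS (subsetUl _ _) lG.
  exact: localS (subsetUr _ _) (@local_dev _ _ e).
- by move=> u; apply: norm_mulr_le1; rewrite ?norm_dev1.
Qed.

(* [total_dev - near_dev A] only involves chords outside [A], so [h] is
   independent of it and the binomial expansion of [(total_dev - near_dev A) ^+ j]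
   has mean zero against [G * h]. *)
Lemma mean_centred_expand (I : finType) (A B : {set I})
    (h G : {perm I * bool} -> R) j :
  [disjoint A & B] -> local A h -> mean h = 0 -> local B G ->
  mean (fun s => G s * h s * total_dev s ^+ j) =
  \sum_(i < j) (-1) ^+ i *
     mean (fun s => G s * h s * near_dev A s ^+ i.+1 * total_dev s ^+ (j - i.+1)) *+ 'C(j, i.+1).
Proof.
move=> dAB lh h0 lG; pose Q s := G s * (total_dev s - near_dev A s) ^+ j.
have lQ : local (~: A) Q.
  apply: localM; last by apply: localX; apply: local_total_devB.
  by apply: (localS _ lG); rewrite -disjoints_subset disjoint_sym.
have dA : [disjoint A & ~: A] by rewrite disjoints_subset setCK.
have := mean_indep dA lh lQ; rewrite h0 mul0r => E0.
apply/eqP; rewrite -subr_eq0; apply/eqP; rewrite -[RHS]E0 -sumrN.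
rewrite (@eq_mean _ _ (fun s => h s * Q s) (fun s => \sum_(i < j.+1) (-1) ^+ i * 
   (G s * h s * near_dev A s ^+ i * total_dev s ^+ (j - i)) *+ 'C(j, i))); last first.
  move=> s; rewrite /Q exprBn !mulr_sumr; apply: eq_bigr => i _.
  by rewrite !mulrnAr; congr (_ *+ _); ring.
(* The term [i = 0] of the binomial expansion is the left-hand side of the claim; the others are
   shifted by one. *)
rewrite mean_sum big_ord_recl /= bin0; congr (_ + _).
  by apply: eq_mean => s; rewrite expr0 mul1r mulr1 subn0.
apply: eq_bigr => i _; rewrite /bump /= add1n.
rewrite [RHS](@eq_mean _ _ _ (fun s => ((-1) ^+ i.+1 *+ 'C(j, i.+1)) *
  (G s * h s * near_dev A s ^+ i.+1 * total_dev s ^+ (j - i.+1)))); last first.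
  by move=> s; rewrite mulrnAl.
by rewrite meanZ exprS mulN1r mulNrn mulNr mulrnAl.
Qed.

End MomentBounds.

(** * Bounds for mixed moments, uniform in the number of chords *)

Section MomentInduction.
Variable R : realFieldType.
Local Open Scope ring_scope.
Local Notation dev := (dev R).
Local Notation total_dev := (total_dev R).

(** [C] may depend on the power and on the size of the support, but neither on the number of chords
    nor on [G]. The exponent is that of the [j]-th power of the standard deviation, rounded down. *)
Definition moment_bound (j s : nat) (C : R) := forall (I : finType) (A : {set I})
    (G : {perm I * bool} -> R), (0 < #|I|)%N -> (#|A| <= s)%N -> local A G ->
  (forall u, `|G u| <= 1) ->
  `|mean (fun u => G u * total_dev u ^+ j)| <= C * #|I|%:R ^+ (3 * j)./2.

Definition expand_cst (j a : nat) : R :=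
  \sum_(i < j) (2 * a)%:R ^+ i.+1 * 'C(j, i.+1)%:R.

Lemma expand_cst_ge0 j a : 0 <= expand_cst j a.
Proof. by apply: sumr_ge0 => i _; rewrite mulr_ge0 ?exprn_ge0. Qed.

Lemma ler_card_exp (I : finType) a b : (0 < #|I|)%N -> (a <= b)%N ->
  #|I|%:R ^+ a <= #|I|%:R ^+ b :> R.
Proof. by move=> I0 ab; apply: ler_weXn2l => //; rewrite ler1n. Qed.

(** With n chords, the [i]-th term has order [i + 1] from the near factors plus the floor of
    [3 (j - i - 1) / 2] from the remaining power, together the floor of [(3 j - i - 1) / 2]. So each
    further near factor saves half a power of n. The support bound allows for [A], [B] and two
    chords per near factor. *)
Lemma expand_tail_le j r a b (C : R) : 0 <= C ->
  (forall j', (j' < j)%N -> moment_bound j' (a + b + 2 * j) C) ->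
  forall (I : finType) (A B : {set I}) (h G : {perm I * bool} -> R),
  (0 < #|I|)%N -> (#|A| <= a)%N -> (#|B| <= b)%N ->
  local A h -> (forall u, `|h u| <= 1) -> local B G -> (forall u, `|G u| <= 1) ->
  `|\sum_(i < j | (r <= i)%N) (-1) ^+ i *
     mean (fun s => G s * h s * near_dev R A s ^+ i.+1 * total_dev s ^+ (j - i.+1)) *+ 'C(j, i.+1)|
  <= expand_cst j a * C * #|I|%:R ^+ (3 * j - r.+1)./2.
Proof.
move=> C0 bnd I A B h G I0 Aa Bb lh h1 lG G1.
apply: le_trans (ler_norm_sum _ _ _) _; rewrite /expand_cst -mulrA mulr_suml.
rewrite big_mkcond /=; apply: ler_sum => i _; case: ifP => ri; last first.
  by rewrite !mulr_ge0 ?exprn_ge0.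
rewrite -mulr_natr normrM normr_nat normrM normrX normrN normr1 expr1n mul1r.
rewrite mulrAC; apply: ler_wpM2r => //.
pose K := C * #|I|%:R ^+ (3 * (j - i.+1))./2.
have K0 : 0 <= K by rewrite mulr_ge0 ?exprn_ge0.
apply: (@le_trans _ _ ((2 * #|A| * #|I|)%:R ^+ i.+1 * K)).
  apply: (@mean_near_dev_le _ _ A (j - i.+1) (a + b + 2 * j) K K0 _ i.+1 (A :|: B)).
  - move=> D Q sD lQ Q1; apply: (bnd (j - i.+1)%N _ I D Q) => //.
    by have := ltn_ord i; lia.
  - have := cardsU A B; have := ltn_ord i.
    by move: (#|_ :|: _|) => x; lia.
  - apply: localM; first exact: localS (subsetUr _ _) lG.
    exact: localS (subsetUl _ _) lh.
  - by move=> u; apply: norm_mulr_le1.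
rewrite natrM exprMn -mulrA; apply: ler_pM; rewrite ?mulr_ge0 ?exprn_ge0 //.
  by rewrite lerXn2r ?nnegrE ?ler0n // ler_nat leq_mul2l Aa orbT.
rewrite /K mulrCA -exprD; apply: ler_wpM2l => //; apply: ler_card_exp => //.
by have := ltn_ord i; lia.
Qed.

(** A centred factor independent of [G] gains half a power of n, before rounding, over
    [moment_bound]: every term of its expansion contains a near factor. *)
Lemma mean_centred_le j a b (C : R) : 0 <= C ->
  (forall j', (j' < j)%N -> moment_bound j' (a + b + 2 * j) C) ->
  forall (I : finType) (A B : {set I}) (h G : {perm I * bool} -> R),
  (0 < #|I|)%N -> (#|A| <= a)%N -> (#|B| <= b)%N -> [disjoint A & B] ->
  local A h -> mean h = 0 -> (forall u, `|h u| <= 1) ->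
  local B G -> (forall u, `|G u| <= 1) ->
  `|mean (fun s => G s * h s * total_dev s ^+ j)| <=
    expand_cst j a * C * #|I|%:R ^+ (3 * j - 1)./2.
Proof.
move=> C0 bnd I A B h G I0 Aa Bb dAB lh h0 h1 lG G1.
rewrite (mean_centred_expand _ dAB) //.
have := expand_tail_le 0 C0 bnd I0 Aa Bb lh h1 lG G1.
by rewrite (eq_bigl xpredT).
Qed.

Lemma moment_boundW j s s' C C' :
  (s' <= s)%N -> C <= C' -> moment_bound j s C -> moment_bound j s' C'.
Proof.
move=> ss CC H I A G I0 As lG G1; apply: le_trans (H I A G I0 _ lG G1) _.
  exact: leq_trans ss.
by apply: ler_wpM2r; rewrite ?exprn_ge0.
Qed.

(* The exponent is rounded down for odd [j]; this is the cancellation that turns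
   the generic rate [n ^ (-1/2)] into [n ^ (-1)] for even moments. *)
Lemma moment_bound_ex j s :
  exists2 C : R, 0 <= C & forall j', (j' <= j)%N -> moment_bound j' s C.
Proof.
elim: j s => [|j IH] s.
  exists 1 => // j'; rewrite leqn0 => /eqP -> I A G I0 _ _ G1.
  rewrite muln0 expr0 mulr1; apply: norm_mean_le => u.
  by rewrite expr0 mulr1.
have [C C0 bnd] := IH (2 + s + 2 * j)%N.
pose D := (2 * s)%:R * C + expand_cst j 2 * C.
have D0 : 0 <= D by rewrite addr_ge0 ?mulr_ge0 ?expand_cst_ge0.
have CCD : C <= C + D by rewrite lerDl.
exists (C + D) => [|j']; first exact: addr_ge0.
rewrite leq_eqVlt => /orP[/eqP->|]; last first.
  by rewrite ltnS => /bnd; apply: moment_boundW => //; lia.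
apply: (@moment_boundW _ s _ D); rewrite ?lerDr // => I B G I0 Bs lG G1.
rewrite (@eq_mean _ _ _ (fun u => \sum_e G u * dev e u * total_dev u ^+ j)); last first.
  move=> u; rewrite exprS {1}/total_dev mulr_suml mulr_sumr; apply: eq_bigr => e _.
  by rewrite mulrA.
have [N defN] : exists N, N = (3 * j.+1)./2 by exists (3 * j.+1)./2.
(* The pairs that touch [B] are only O(n) many, so the bound for the power [j] suffices. The other
   pairs may be n ^ 2 many, but their deviations are centred and local away from [B], so
   [mean_centred_le] applies. *)
rewrite -defN mean_sum (bigID (touches B)) /= (le_trans (ler_normD _ _)) //.
rewrite /D mulrDl; apply: lerD; apply: le_trans (ler_norm_sum _ _ _) _.
  apply: le_trans (sum_touches_le (K := C * #|I|%:R ^+ (3 * j)./2) _ _) _.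
  - move=> e _; apply: (bnd j _ I (B :|: ends e)) => //.
    + have := cardsU B (ends e); have := card_ends e.
      by move: (#|_ :|: _|) => x; lia.
    + apply: localM; first exact: localS (subsetUl _ _) lG.
      exact: localS (subsetUr _ _) (@local_dev _ _ e).
    + by move=> u; apply: norm_mulr_le1; rewrite ?norm_dev1.
  - by rewrite mulr_ge0 ?exprn_ge0.
  rewrite natrM [leLHS](_ : _ = (2 * #|B|)%:R * C * #|I|%:R ^+ (3 * j)./2.+1); last first.
    by rewrite exprS; ring.
  apply: ler_pM; rewrite ?mulr_ge0 ?exprn_ge0 //; last by apply: ler_card_exp; lia.
  by apply: ler_wpM2r => //; rewrite ler_nat leq_mul2l Bs orbT.
apply: le_trans (sum_pairs_le (K := expand_cst j 2 * C * #|I|%:R ^+ (3 * j - 1)./2) _ _) _.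
- move=> e /touches_disjoint eB; apply: (@mean_centred_le j 2 s C C0 _ I (ends e) B) => //.
  + by move=> k kj; apply: (moment_boundW _ _ (bnd k (ltnW kj))).
  + exact: card_ends.
  + exact: local_dev.
  + exact: mean_dev.
  + by move=> u; apply: norm_dev1.
- by rewrite !mulr_ge0 ?expand_cst_ge0 ?exprn_ge0.
(* At [j = 0] the subtraction in [3 * j - 1] truncates and the exponents do not match, but there
   [expand_cst] is an empty sum. *)
case: j {IH bnd D D0 CCD} defN => [|j] defN.
  by rewrite /expand_cst big_ord0 !mul0r mulr0.
rewrite mulrCA -exprD; apply: ler_wpM2l; first by rewrite mulr_ge0 ?expand_cst_ge0.
by apply: ler_card_exp => //; lia.
Qed.

End MomentInduction.

(** * The approximate Gaussian recursion and the convergence rate of even moments *)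

Section MomentAsymptotics.
Variable R : realFieldType.
Local Open Scope ring_scope.
Local Notation dev := (dev R).
Local Notation total_dev := (total_dev R).

Lemma total_dev_powS (I : finType) k (s : {perm I * bool}) :
  total_dev s ^+ k.+1 = \sum_e 1 * dev e s * total_dev s ^+ k.
Proof. by rewrite exprS {1}/total_dev mulr_suml; apply: eq_bigr => e _; rewrite mul1r. Qed.

(** Disjoint pairs are uncorrelated. What is left is the double sum that the linear term of the
    expansion produces in [moment_rec]. *)
Lemma sigma2E (I : finType) :
  sigma2 R I = \sum_(e : I * I) \sum_(e' | touches (ends e) e')
    mean (fun s => dev e s * dev e' s).
Proof.
rewrite /sigma2 (@eq_mean _ I _
  (fun s => \sum_(e : I * I) \sum_(e' : I * I) dev e s * dev e' s)); last first.
  by move=> s; rewrite expr2 /total_dev mulr_suml; apply: eq_bigr => e _; rewrite mulr_sumr.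
rewrite mean_sum; apply: eq_bigr => e _; rewrite mean_sum [RHS]big_mkcond /=.
apply: eq_bigr => e' _; case: ifPn => // /touches_disjoint dis.
by apply: cov_dev_disjoint; rewrite disjoint_sym.
Qed.

(** Expand around each [dev e]. The linear term contains the products [dev e * dev e'] with [e']
    meeting [e]; replacing them by their means gives the [sigma2] term. The replacement error is
    centred and local on at most four chords, so [mean_centred_le] bounds it, and the sum has O(n ^
    3) such terms. The higher terms are a tail with [r = 1], summed over n ^ 2 pairs. *)
Lemma moment_rec k : exists2 C : R, 0 <= C & forall I : finType, (0 < #|I|)%N ->
  `|mean (fun s : {perm I * bool} => total_dev s ^+ k.+2)
     - k.+1%:R * sigma2 R I * mean (fun s : {perm I * bool} => total_dev s ^+ k)|
  <= C * #|I|%:R ^+ (3 * k + 5)./2.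
Proof.
(* Keeps the centred products [h] within the bound 1 that [mean_centred_le] asks for. *)
have le89 : 2 / 3 * (2 / 3) + 2 / 3 * (2 / 3) <= 1 :> R by lra.
have [C C0 bnd] := moment_bound_ex R k.+1 (2 + 2 * k.+1 + (4 + 2 * k)).
pose C1 := expand_cst R k.+1 2 * C; pose C2 := k.+1%:R * (8 * (expand_cst R k 4 * C)).
have C10 : 0 <= C1 by rewrite mulr_ge0 ?expand_cst_ge0.
have C20 : 0 <= C2 by rewrite !mulr_ge0 ?expand_cst_ge0.
exists (C1 + C2) => [|I I0]; first exact: addr_ge0.
pose dev2 (e e' : I * I) (s : {perm I * bool}) := dev e s * dev e' s.
pose h e e' s := dev2 e e' s - mean (dev2 e e').
pose tail (e : I * I) := \sum_(i < k.+1 | (1 <= i)%N) (-1) ^+ i *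
     mean (fun s => 1 * dev e s * near_dev R (ends e) s ^+ i.+1 * total_dev s ^+ (k.+1 - i.+1))
     *+ 'C(k.+1, i.+1).
have l1 : local (set0 : {set I}) (fun=> 1 : R) by [].
have n1 (u : {perm I * bool}) : `|1| <= 1 :> R by rewrite normr1.
have expand e : mean (fun s => 1 * dev e s * total_dev s ^+ k.+1) =
   k.+1%:R * (\sum_(e' | touches (ends e) e') mean (fun s => dev2 e e' s * total_dev s ^+ k))
   + tail e.
  rewrite (@mean_centred_expand _ _ (ends e) set0) ?mean_dev //; last exact: local_dev.
    rewrite (bigD1 ord0) //= bin1 expr0 mul1r mulr_natl; congr (_ *+ _ + _).
      rewrite -mean_sum; apply: eq_mean => s; rewrite subSS subn0 expr1 mul1r.
      rewrite /near_dev mulr_sumr mulr_suml; apply: eq_bigr => e' _; rewrite /dev2; ring.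
    by apply: eq_bigl => i; rewrite lt0n.
  by rewrite disjoint_sym disjoints_subset sub0set.
rewrite (@eq_mean _ _ _ _ (total_dev_powS k.+1)) mean_sum (eq_bigr _ (fun e _ => expand e)).
rewrite big_split /= addrAC addrC mulrDl.
apply: le_trans (ler_normD _ _) _; apply: lerD.
  apply: le_trans (ler_norm_sum _ _ _) _.
  apply: le_trans (sum_pairs_le (K := C1 * #|I|%:R ^+ (3 * k.+1 - 2)./2) _ _) _.
  - move=> e _; apply: (@expand_tail_le _ k.+1 1 2 0 C C0 _ I (ends e) set0) => //.
    + by move=> j jk; apply: (moment_boundW _ _ (bnd j (ltnW jk))) => //; lia.
    + exact: card_ends.
    + by rewrite cards0.
    + exact: local_dev.
    + by move=> u; apply: norm_dev1.
  - by rewrite mulr_ge0 ?exprn_ge0.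
  rewrite mulrCA -exprD; apply: ler_wpM2l => //; apply: ler_card_exp => //; lia.
have -> : \sum_e k.+1%:R * (\sum_(e' | touches (ends e) e') mean (fun s => dev2 e e' s * total_dev s ^+ k))
    - k.+1%:R * sigma2 R I * mean (fun s : {perm I * bool} => total_dev s ^+ k) =
  k.+1%:R * \sum_e \sum_(e' | touches (ends e) e') mean (fun s => 1 * h e e' s * total_dev s ^+ k).
  rewrite -mulr_sumr -mulrA -mulrBr; congr (_ * _).
  rewrite sigma2E mulr_suml -sumrB; apply: eq_bigr => e _.
  rewrite mulr_suml -sumrB; apply: eq_bigr => e' _.
  by rewrite -meanZ -meanB; apply: eq_mean => s; rewrite /h mul1r mulrBl.
rewrite /C2 normrM normr_nat -[leRHS]mulrA; apply: ler_wpM2l => //.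
apply: le_trans (ler_norm_sum _ _ _) _.
pose K := expand_cst R k 4 * C * #|I|%:R ^+ (3 * k - 1)./2.
have K0 : 0 <= K by rewrite !mulr_ge0 ?expand_cst_ge0 ?exprn_ge0.
apply: le_trans (sum_pairs_le (K := (8 * #|I|)%:R * K) _ _) _.
- move=> e _; apply: le_trans (ler_norm_sum _ _ _) _.
  apply: le_trans (sum_touches_le (K := K) _ _) _ => //; last first.
    by apply: ler_wpM2r => //; rewrite ler_nat; have := card_ends e; nia.
  move=> e' _.
  have l2 : local (ends e :|: ends e') (dev2 e e').
    apply: localM; first exact: localS (subsetUl _ _) (@local_dev _ _ e).
    exact: localS (subsetUr _ _) (@local_dev _ _ e').
  have dev2b u : `|dev2 e e' u| <= 2 / 3 * (2 / 3).
    by rewrite normrM; apply: ler_pM; rewrite ?norm_dev.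
  apply: (@mean_centred_le _ k 4 0 C C0 _ I (ends e :|: ends e') set0) => //.
  + by move=> j jk; apply: (moment_boundW _ _ (bnd j (leqW (ltnW jk)))) => //; lia.
  + have := cardsU (ends e) (ends e'); have := card_ends e; have := card_ends e'.
    by move: (#|_ :|: _|) => x; lia.
  + by rewrite cards0.
  + by rewrite disjoint_sym disjoints_subset sub0set.
  + by apply: localD => //; apply: localN; apply: local_cst.
  + by rewrite /h meanB mean_cst subrr.
  + move=> u; apply: le_trans (ler_normB _ _) _.
    exact: le_trans (lerD (dev2b u) (norm_mean_le dev2b)) le89.
- by rewrite mulr_ge0.
(* Again the truncated exponent at [k = 0] is harmless because [expand_cst] vanishes. *)
rewrite /K natrM; case: k @K C1 C2 {bnd C10 C20 h tail expand K0} => [|k] *.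
  by rewrite /expand_cst big_ord0 !mul0r !mulr0 mul0r.
have -> : #|I|%:R ^+ 2 * (8 * #|I|%:R * (expand_cst R k.+1 4 * C * #|I|%:R ^+ (3 * k.+1 - 1)./2))
  = 8 * (expand_cst R k.+1 4 * C) * #|I|%:R ^+ (3 + (3 * k.+1 - 1)./2).
  by rewrite exprD; ring.
apply: ler_wpM2l; first by rewrite !mulr_ge0 ?expand_cst_ge0.
by apply: ler_card_exp => //; lia.
Qed.

(** The double factorial of [2 m - 1], which is the moment of order [2 m] of the standard normal
    law. *)
Definition odd_fact (m : nat) : nat := \prod_(i < m) (2 * i).+1.

(** The factor [#|I|] on the left avoids the exponent [3 m - 1] at [m = 0]. In the induction the
    error of [moment_rec] for [k = 2 m] has exponent [3 m + 2], and the inherited error is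
    multiplied by [sigma2], which is O(n ^ 3). *)
Lemma even_moment m : exists2 C : R, 0 <= C & forall I : finType, (0 < #|I|)%N ->
  #|I|%:R * `|mean (fun s : {perm I * bool} => total_dev s ^+ (2 * m))
     - (odd_fact m)%:R * sigma2 R I ^+ m| <= C * #|I|%:R ^+ (3 * m).
Proof.
elim: m => [|m [C C0 IH]].
  exists 0 => // I I0; rewrite muln0 /odd_fact big_ord0 expr0 mulr1.
  have -> : mean (fun s : {perm I * bool} => total_dev s ^+ 0) = 1.
    by rewrite -[RHS](@mean_cst R I); apply: eq_mean => s; rewrite expr0.
  by rewrite subrr normr0 mulr0 mul0r.
have [D D0 rec] := moment_rec (2 * m); have [E E0 bnd] := moment_bound_ex R 2 0.
exists (D + (2 * m).+1%:R * E * C) => [|I I0]; first by rewrite addr_ge0 ?mulr_ge0.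
have s2 : `|sigma2 R I| <= E * #|I|%:R ^+ 3.
  have c0 : (#|@set0 I| <= 0)%N by rewrite cards0.
  have l1 : local (set0 : {set I}) (fun=> 1 : R) by [].
  have n1 (u : {perm I * bool}) : `|1| <= 1 :> R by rewrite normr1.
  apply: le_trans (bnd 2 (leqnn _) I set0 (fun=> 1) I0 c0 l1 n1).
  rewrite /sigma2 le_eqVlt; apply/orP; left; apply/eqP; congr `| _ |.
  by apply: eq_mean => s; rewrite mul1r.
have -> : (2 * m.+1 = (2 * m).+2)%N by lia.
rewrite /odd_fact big_ord_recr /= -/(odd_fact m) natrM exprSr.
set M2 := mean _; set M := mean (fun s : {perm I * bool} => total_dev s ^+ (2 * m)) in IH *.
have -> : M2 - (odd_fact m)%:R * (2 * m).+1%:R * (sigma2 R I ^+ m * sigma2 R I)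
  = (M2 - (2 * m).+1%:R * sigma2 R I * M)
    + (2 * m).+1%:R * sigma2 R I * (M - (odd_fact m)%:R * sigma2 R I ^+ m) by ring.
have n0 : 0 <= #|I|%:R :> R by [].
apply: le_trans (ler_wpM2l n0 (ler_normD _ _)) _; rewrite mulrDr mulrDl.
apply: lerD.
  apply: le_trans (ler_wpM2l n0 (rec I I0)) _; rewrite mulrCA -exprS.
  by apply: ler_wpM2l => //; apply: ler_card_exp => //; lia.
rewrite (normrM (_ * _)) (normrM (2 * m).+1%:R) normr_nat; set Delta := `|M - _| in IH *.
rewrite [leLHS](_ : _ = (2 * m).+1%:R * (`|sigma2 R I| * (#|I|%:R * Delta))); last by ring.
rewrite -[leRHS]mulrA -[leRHS]mulrA; apply: ler_wpM2l => //.
have -> : E * (C * #|I|%:R ^+ (3 * m.+1)) = E * #|I|%:R ^+ 3 * (C * #|I|%:R ^+ (3 * m)).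
  by rewrite mulnS exprD; ring.
by apply: ler_pM => //; [rewrite mulr_ge0 ?normr_ge0|exact: IH].
Qed.

Theorem even_moment_rate m : exists C : R, forall I : finType, (1 < #|I|)%N ->
  `|mean (fun s : {perm I * bool} => total_dev s ^+ (2 * m)) / sigma2 R I ^+ m
     - (odd_fact m)%:R| <= C / #|I|%:R.
Proof.
have [C C0 H] := even_moment m; exists (C * 180 ^+ m) => I I1.
have I0 : (0 < #|I|)%N by apply: ltnW.
have n0 : 0 < #|I|%:R :> R by rewrite ltr0n.
(* 180 is 45 * 4, because n - 1 is at least n / 2 for n at least 2. *)
have s2 : #|I|%:R ^+ 3 / 180 <= sigma2 R I.
  apply: le_trans (sigma2_ge R I).
  have h : #|I|%:R / 2 <= #|I|.-1%:R :> R.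
    by rewrite ler_pdivrMr // -natrM ler_nat; lia.
  have h2 : (#|I|%:R / 2) ^+ 2 <= #|I|.-1%:R ^+ 2 :> R.
    by rewrite lerXn2r ?nnegrE ?divr_ge0.
  by nra.
have s0 : 0 < sigma2 R I.
  by apply: lt_le_trans s2; rewrite divr_gt0 ?exprn_gt0.
have sm0 : 0 < sigma2 R I ^+ m by apply: exprn_gt0.
set M := mean _.
have -> : M / sigma2 R I ^+ m - (odd_fact m)%:R =
   (M - (odd_fact m)%:R * sigma2 R I ^+ m) / sigma2 R I ^+ m.
  by rewrite mulrBl mulfK // gt_eqF.
rewrite normrM normfV (gtr0_norm sm0) ler_pdivrMr // mulrAC ler_pdivlMr // mulrC.
apply: le_trans (H I I0) _; rewrite -mulrA; apply: ler_wpM2l => //.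
rewrite exprM -exprMn lerXn2r ?nnegrE ?exprn_ge0 ?(mulr_ge0 _ (ltW s0)) //.
by rewrite mulrC -ler_pdivrMr.
Qed.

End MomentAsymptotics.

(** * Random matchings *)

Section Matchings.
Variable n : nat.
Local Notation J := ('I_n * bool)%type.
Implicit Types (s t : {perm J}) (p : {set {set 'I_(2 * n)}}).

Lemma card_ends_type : #|{: J}| = (2 * n)%N.
Proof. by rewrite card_prod card_ord card_bool mulnC. Qed.

Definition slot (x : J) : 'I_(2 * n) := cast_ord card_ends_type (enum_rank x).
Definition unslot (k : 'I_(2 * n)) : J := enum_val (cast_ord (esym card_ends_type) k).

Lemma slotK : cancel slot unslot.
Proof. by move=> x; rewrite /slot /unslot cast_ordK enum_rankK. Qed.

Lemma unslotK : cancel unslot slot.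
Proof. by move=> k; rewrite /slot /unslot enum_valK cast_ordKV. Qed.

Definition chord s (i : 'I_n) : {set 'I_(2 * n)} :=
  [set slot (s (i, false)); slot (s (i, true))].

Definition matching s : {set {set 'I_(2 * n)}} := [set chord s i | i : 'I_n].

Lemma slot_perm_inj s : injective (fun x => slot (s x)).
Proof. by move=> x y /(can_inj slotK)/perm_inj. Qed.

Lemma chordP s i k : reflect (exists b, k = slot (s (i, b))) (k \in chord s i).
Proof.
rewrite !inE; apply: (iffP orP) => [[/eqP->|/eqP->]|[[] ->]];
  by [exists false | exists true | right | left].
Qed.

Lemma chord_inj s i j k : k \in chord s i -> k \in chord s j -> i = j.
Proof. by move=> /chordP[b ->] /chordP[b' /slot_perm_inj[]]. Qed.

Lemma pair_partition_matching s : pair_partition (matching s).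
Proof.
apply/andP; split; last first.
  apply/forall_inP => _ /imsetP[i _ ->]; rewrite cards2.
  by rewrite (inj_eq (@slot_perm_inj s)) xpair_eqE andbF.
apply/and3P; split.
- rewrite eqEsubset subsetT; apply/subsetP => k _; apply/bigcupP.
  case sE: ((s^-1)%g (unslot k)) => [i b].
  exists (chord s i); first exact: imset_f.
  by apply/chordP; exists b; rewrite -sE permKV unslotK.
- apply/trivIsetP => _ _ /imsetP[i _ ->] /imsetP[j _ ->] ij.
  apply/pred0P => k /=; apply/negP => /andP[ki kj].
  by rewrite (chord_inj ki kj) eqxx in ij.
- apply/imsetP => -[i _ E]; have := set21 (slot (s (i, false))) (slot (s (i, true))).
  by rewrite -/(chord s i) -E inE.
Qed.

(** There are [n] blocks, so they can be numbered by the chords; the Boolean of a chord end is the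
    index of its place in the enumeration of the block. *)
Lemma matching_surj p : pair_partition p -> exists s, matching s = p.
Proof.
case/andP => /and3P[/eqP covp trivp p0] /forall_inP p2.
have cardp : #|p| = n.
  have := @card_uniform_partition _ 2 p setT (fun B Bp => eqP (p2 B Bp)).
  rewrite /partition covp eqxx trivp p0 cardsT card_ord => /(_ isT); lia.
pose B (i : 'I_n) : {set 'I_(2 * n)} := enum_val (cast_ord (esym cardp) i).
have Bp i : B i \in p by apply: enum_valP.
have B_inj : injective B by move=> i j /enum_val_inj/cast_ord_inj.
have szB i : size (enum (B i)) = 2 by rewrite -cardE (eqP (p2 _ (Bp i))).
pose pt (x : J) := nth (slot x) (enum (B x.1)) x.2.
have ptB x : pt x \in B x.1.
  by rewrite -mem_enum mem_nth // szB; case: x.2.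
have pt_inj : injective pt.
  move=> [i b] [j b'] E.
  have ij : i = j.
    apply: B_inj; apply/eqP; apply/idPn => neq.
    have /pred0P/(_ (pt (i, b))) /= := trivIsetP trivp _ _ (Bp i) (Bp j) neq.
    by rewrite (ptB (i, b)) E (ptB (j, b')).
  have lt2 (c : bool) : c < size (enum (B i)) by rewrite szB; case: c.
  move: E; rewrite -ij /pt /= (@set_nth_default _ _ (slot (i, b')) (slot (i, b)) b) ?lt2 //.
  by move/eqP; rewrite nth_uniq ?enum_uniq ?lt2 //; case: b b' => -[].
have s_inj : injective (fun x => unslot (pt x)).
  by move=> x y /(can_inj unslotK)/pt_inj.
exists (perm s_inj); have chordE i : chord (perm s_inj) i = B i.
  apply/eqP; rewrite eqEcard (eqP (p2 _ (Bp i))) cards2 (inj_eq (@slot_perm_inj _)).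
  rewrite xpair_eqE !andbF andbT; apply/subsetP => k /chordP[b ->].
  by rewrite permE unslotK; apply: (ptB (i, b)).
have chord_perm_inj : injective (chord (perm s_inj)).
  by move=> i j; rewrite !chordE; apply: B_inj.
apply/eqP; rewrite eqEcard; apply/andP; split.
  by apply/subsetP => _ /imsetP[i _ ->]; rewrite chordE Bp.
by rewrite cardp card_imset // card_ord.
Qed.

Definition relabel s (k : 'I_(2 * n)) := slot (s (unslot k)).

(** Right multiplication acts on matchings by permuting the places, which makes the fibres of
    [matching] cosets. *)
Lemma matchingM t s : matching (t * s)%g = 
  [set [set relabel s k | k in B] | B : {set 'I_(2 * n)} in matching t].
Proof.
rewrite -imset_comp; apply: eq_imset => i /=.
by rewrite /chord imsetU !imset_set1 !permM /relabel !slotK.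
Qed.

Lemma relabel_inj s : injective (relabel s).
Proof. by move=> k l /slot_perm_inj/(can_inj unslotK). Qed.

(* The fibre over [matching s] is the coset of [s] under the stabiliser of
   [matching 1], so all fibres have the same size. *)
Lemma card_matching_fibre s :
  #|[set t | matching t == matching s]| = #|[set t | matching t == matching 1%g]|.
Proof.
rewrite -[RHS](card_imset _ (mulIg s)); apply: eq_card => u.
apply/idP/imsetP => [|[t]]; rewrite inE => /eqP E; last first.
  by move=> ->; rewrite inE matchingM E -matchingM mul1g.
exists (u * s^-1)%g; last by rewrite mulgKV.
rewrite inE; apply/eqP; apply: (imset_inj (imset_inj (@relabel_inj s))).
by rewrite -!matchingM mulgKV mul1g.
Qed.

(** All fibres of [matching] over pair partitions have the same size [N]. The constant function 1
    expresses the number of permutations through [N], which then cancels. *)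
Lemma mean_matching (R : realFieldType) (f : {set {set 'I_(2 * n)}} -> R) :
  (mean (fun s => f (matching s)) =
   (\sum_(p | pair_partition p) f p) / (num_pair_partitions n)%:R)%R.
Proof.
pose N := #|[set t | matching t == matching 1%g]|.
have sumE (h : {set {set 'I_(2 * n)}} -> R) :
  (\sum_s h (matching s) = N%:R * \sum_(p | pair_partition p) h p)%R.
  rewrite (partition_big matching (fun p => pair_partition p)) /=; last first.
    by move=> s _; apply: pair_partition_matching.
  rewrite GRing.mulr_sumr; apply: eq_bigr => p /matching_surj[s <-].
  rewrite (eq_bigr (fun=> h (matching s))); last by move=> t /eqP ->.
  rewrite sumr_const GRing.mulr_natl /N -(card_matching_fibre s).
  by congr (_ *+ _)%R; apply: eq_card => t; rewrite inE.
have N0 : (N%:R != 0 :> R)%R.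
  by rewrite pnatr_eq0 -lt0n; apply/card_gt0P; exists 1%g; rewrite inE.
rewrite /mean sumE; have := sumE (fun=> 1%R).
rewrite !sumr_const => ->; rewrite /num_pair_partitions cardsE.
by rewrite -mulf_div divff // mul1r.
Qed.

Definition lo s i := minn (pos s (i, false)) (pos s (i, true)).
Definition hi s i := maxn (pos s (i, false)) (pos s (i, true)).

(** The chords interleave: this is a crossing, oriented so that the chord that starts first comes
    first. Each crossing is thus counted in one of the two orders of its chords. *)
Definition nested_start s (e : 'I_n * 'I_n) :=
  [&& lo s e.1 < lo s e.2, lo s e.2 < hi s e.1 & hi s e.1 < hi s e.2].

Lemma crossi_nested s i j : i != j ->
  (crossi (i, j) s = nested_start s (i, j) + nested_start s (j, i) :> nat)%N.
Proof.
move=> ij; have neq b b' : pos s (i, b) != pos s (j, b').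
  by rewrite (inj_eq (@pos_inj _ s)) xpair_eqE (negbTE ij).
have neq' k : pos s (k, false) != pos s (k, true).
  by rewrite (inj_eq (@pos_inj _ s)) xpair_eqE andbF.
rewrite /crossi /nested_start /cross /lo /hi /=.
have := neq false false; have := neq false true; have := neq true false.
have := neq true true; have := neq' i; have := neq' j.
move: (pos s _) (pos s _) (pos s _) (pos s _) => a b c d.
by lia.
Qed.

(** The comparison itself is the Boolean that names the earlier end. *)
Definition first_end s (i : 'I_n) : 'I_(2 * n) :=
  slot (s (i, pos s (i, true) < pos s (i, false))).
Definition last_end s (i : 'I_n) : 'I_(2 * n) :=
  slot (s (i, pos s (i, false) < pos s (i, true))).

Lemma pos_ends_neq s i : pos s (i, false) != pos s (i, true).
Proof. by rewrite (inj_eq (@pos_inj _ s)) xpair_eqE andbF. Qed.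

Lemma val_first_end s i : first_end s i = lo s i :> nat.
Proof.
rewrite /first_end /lo; change (pos s (i, pos s (i, true) < pos s (i, false)) = lo s i).
by rewrite /lo; case: ltngtP (pos_ends_neq s i) => //= /eqP.
Qed.

Lemma val_last_end s i : last_end s i = hi s i :> nat.
Proof.
rewrite /last_end /hi; change (pos s (i, pos s (i, false) < pos s (i, true)) = hi s i).
by rewrite /hi; case: ltngtP (pos_ends_neq s i) => //= /eqP.
Qed.

Lemma chordE s i : chord s i = [set first_end s i; last_end s i].
Proof.
rewrite /chord /first_end /last_end.
by case: ltngtP (pos_ends_neq s i) => //=; rewrite setUC.
Qed.

Lemma first_end_chord s i : first_end s i \in chord s i.
Proof. by apply/chordP; eexists. Qed.

Lemma chord_ends s i (k l : 'I_(2 * n)) :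
  k < l -> [set k; l] = chord s i -> k = first_end s i /\ l = last_end s i.
Proof.
move=> kl E; have := set22 k l; have := set21 k l; rewrite E chordE !inE.
have: lo s i <= hi s i by apply: leq_trans (geq_minl _ _) (leq_maxl _ _).
rewrite -val_first_end -val_last_end => le_.
move=> /orP[/eqP kE|/eqP kE] /orP[/eqP lE|/eqP lE]; subst k l => //;
  by move: kl; rewrite ?ltnn // ltnNge le_.
Qed.

(** In increasing order a crossing lists the first ends of its two chords and then their last ends,
    so [F] maps the interleaving pairs bijectively to the crossings. *)
Lemma crossings_matching s : crossings (matching s) = \sum_e nested_start s e.
Proof.
pose F (e : 'I_n * 'I_n) :=
  (first_end s e.1, first_end s e.2, last_end s e.1, last_end s e.2).
have F_inj : injective F.
  have inj i k : first_end s i = first_end s k -> i = k.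
    move=> E; apply: (@chord_inj s _ _ (first_end s i)); first exact: first_end_chord.
    by rewrite E first_end_chord.
  move=> [i j] [k l] E; congr (_, _); apply: inj.
    exact: (congr1 (fun q => q.1.1.1) E).
  exact: (congr1 (fun q => q.1.1.2) E).
rewrite /crossings -big_mkcond sum1_card -(card_imset _ F_inj).
apply: eq_card => -[[[w x] y] z]; rewrite inE /crossing.
apply/idP/imsetP => [|[[i j] + [-> -> -> ->]]]; last first.
  rewrite /nested_start -topredE /= -!val_first_end -!val_last_end.
  by case/and3P => -> -> ->; rewrite -!chordE !imset_f.
case/and5P => wx xy yz /imsetP[i _ wyE] /imsetP[j _ xzE].
have [wE yE] := chord_ends (ltn_trans wx xy) wyE.
have [xE zE] := chord_ends (ltn_trans xy yz) xzE.
exists (i, j); last by rewrite /F /= -wE -xE -yE -zE.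
rewrite -topredE /= /nested_start /= -!val_first_end -!val_last_end.
by rewrite -wE -xE -yE -zE wx xy yz.
Qed.

(** Ordered pairs count each crossing twice. The constant is left unspecified since centring removes
    it. *)
Lemma total_dev_matching (R : realFieldType) :
  {c : R | forall s, (total_dev R s = 2 * (crossings (matching s))%:R - c)%R}.
Proof.
exists (\sum_(e : 'I_n * 'I_n) (e.1 != e.2)%:R / 3)%R => s.
rewrite /total_dev crossings_matching.
have E2 : ((2 * \sum_e nested_start s e)%N =
   \sum_(e : 'I_n * 'I_n) (e.1 != e.2) * crossi e s)%N.
  rewrite mul2n -addnn.
  have swap : \sum_e nested_start s e = \sum_(e : 'I_n * 'I_n) nested_start s (e.2, e.1).
    rewrite (reindex_inj (h := fun e : 'I_n * 'I_n => (e.2, e.1))) //.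
    by move=> [i j] [k l] [-> ->].
  rewrite {2}swap -big_split; apply: eq_bigr => -[i j] _ /=.
  have [<-|ij] := eqVneq i j; last by rewrite crossi_nested ?mul1n.
  by rewrite /nested_start /= ltnn.
rewrite -natrM E2 natr_sum -sumrB; apply: eq_bigr => e _.
rewrite /dev; case: eqP => _ /=; first by rewrite mul0r subr0.
by rewrite !mul1n.
Qed.

End Matchings.

From mathcomp Require Import all_classical all_reals all_analysis measurable_realfun.
Import numFieldNormedType.Exports.

(** * Gaussian moments *)

Section NormalDensity.
Context {R : realType}.
Local Open Scope classical_set_scope.
Local Open Scope ring_scope.
Local Open Scope ereal_scope.
Local Notation mu := (@lebesgue_measure R).
Local Notation phi := (normal_pdf (0 : R) 1).

Lemma integral_normal_indic (E : set R) : measurable E ->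
  \int[normal_prob (0 : R) 1]_x (\1_E x)%:E = \int[mu]_x ((\1_E x)%:E * (phi x)%:E).
Proof.
move=> mE; rewrite integral_indic// setIT /normal_prob [LHS]integral_mkcond.
apply: eq_integral => x _; rewrite patchE indicE.
by case: (x \in E); rewrite ?mul1e ?mul0e.
Qed.

Lemma phi_ge0 (x : R) : 0 <= (phi x)%:E.
Proof. by rewrite lee_fin normal_pdf_ge0. Qed.

Lemma measurable_phi : measurable_fun [set: R] (EFin \o phi).
Proof. by apply/measurable_EFinP; exact: measurable_normal_pdf. Qed.

Import HBNNSimple.

Lemma integral_normal_nnsfun (f : {nnsfun _ >-> R}) :
  \int[normal_prob (0 : R) 1]_x (f x)%:E = \int[mu]_x ((f x)%:E * (phi x)%:E).
Proof.
under [LHS]eq_integral do rewrite fimfunE -fsumEFin//.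
rewrite [LHS]ge0_integral_fsum//; last 2 first.
  - by move=> r; exact/measurable_EFinP/measurableT_comp.
  - by move=> n x _; rewrite EFinM nnfun_muleindic_ge0.
under [RHS]eq_integral.
  move=> x xD; rewrite fimfunE -fsumEFin// ge0_mule_fsuml; last first.
    by move=> r; rewrite EFinM nnfun_muleindic_ge0.
  over.
rewrite [RHS]ge0_integral_fsum//; last 2 first.
  - move=> r; apply: emeasurable_funM; last exact: measurable_phi.
    by apply/measurable_EFinP; exact/measurableT_comp.
  - by move=> n x _; rewrite mule_ge0 ?phi_ge0// EFinM nnfun_muleindic_ge0.
apply: eq_fsbigr => r _.
have mE : measurable (f @^-1` [set r]) by [].
rewrite integralZl_indic_nnsfun// integral_normal_indic; last exact: mE.
(* A negative [r] is not a value of [f], so both sides vanish. *)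
have [r0|r0] := leP 0%R r.
  rewrite -ge0_integralZl//.
  - by apply: eq_integral => x _; rewrite EFinM muleA.
  - by apply: emeasurable_funM; [exact/measurable_EFinP/measurable_indic|exact: measurable_phi].
  - by move=> x _; rewrite mule_ge0 ?phi_ge0 // lee_fin.
have -> : f @^-1` [set r] = set0.
  by apply/seteqP; split => x //= fx; have : (0 <= f x)%R := fun_ge0 x; rewrite fx leNgt r0.
transitivity (0 : \bar R).
  by rewrite integral0_eq ?mule0// => x _; rewrite indic0 mul0e.
by apply/esym/integral0_eq => x _; rewrite indic0 mulr0 mul0e.
Qed.

(** Passes from simple functions to the limit by monotone convergence on both sides. *)
Lemma integral_normal_prob (f : _ -> \bar R) :
  measurable_fun setT f -> (forall x, 0 <= f x) ->
  \int[normal_prob (0 : R) 1]_x f x = \int[mu]_x (f x * (phi x)%:E).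
Proof.
move=> mf f0; pose f_ := nnsfun_approx measurableT mf.
transitivity (lim (\int[normal_prob (0 : R) 1]_x (f_ n x)%:E @[n --> \oo])).
  rewrite -monotone_convergence//=.
  - by apply: eq_integral => ? _; apply/esym/cvg_lim => //=; exact: cvg_nnsfun_approx.
  - by move=> n; exact/measurable_EFinP/measurable_funTS.
  - by move=> n ? _; rewrite lee_fin.
  - by move=> ? _ ? ? mn; rewrite lee_fin; exact/lefP/nd_nnsfun_approx.
transitivity (lim (\int[mu]_x ((f_ n x)%:E * (phi x)%:E) @[n --> \oo])).
  by apply: congr_lim; apply/funext => n /=; exact: integral_normal_nnsfun.
rewrite -monotone_convergence//=.
- apply: eq_integral => x _; apply/cvg_lim => //=.
  by apply: cvgeZr => //; exact: cvg_nnsfun_approx.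
- move=> n; apply: emeasurable_funM; last exact: measurable_phi.
  exact/measurable_EFinP/measurable_funTS.
- by move=> n x _; rewrite mule_ge0 ?phi_ge0// lee_fin.
- move=> x _ a b ab; apply: lee_wpmul2r; rewrite ?phi_ge0// lee_fin.
  exact/lefP/nd_nnsfun_approx.
Qed.

End NormalDensity.

(** * Derivatives and decay of the moment integrands *)

Section GaussianRecursion.
Context {R : realType}.
Local Open Scope classical_set_scope.
Local Open Scope ring_scope.
Local Notation mu := (@lebesgue_measure R).
Local Notation phi := (normal_pdf (0 : R) 1).

Lemma phiE (x : R) : phi x = normal_peak (1 : R) * expR (- x ^+ 2 / 2).
Proof. by rewrite normal_pdfE ?oner_neq0// /normal_fun subr0 expr1n. Qed.

Lemma is_derive_phi (x : R) : is_derive x 1 phi (- x * phi x).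
Proof.
have E : phi = (normal_peak (1 : R) \*: (expR \o (fun y : R => - (2^-1) * y ^+ 2)))%R.
  by apply/funext => y; rewrite phiE /=; congr (_ * expR _); rewrite mulrC mulrN mulNr.
rewrite phiE E; apply: is_derive_eq.
rewrite (_ : - x ^+ 2 / 2 = - 2^-1 * x ^+ 2); last by rewrite mulNr mulrC mulNr.
by rewrite /GRing.scale /= !mulr1; field.
Qed.

Definition gmom k (x : R) : R := x ^+ k * phi x.

(** Integrating this identity takes the place of an integration by parts. *)
Lemma is_derive_gmom k (x : R) :
  is_derive x 1 (gmom k.+1) (k.+1%:R * gmom k x - gmom k.+2 x).
Proof.
have h := is_derive_phi x.
have E : gmom k.+1 = (@id R ^+ k.+1) * phi.
  by apply/funext => y; rewrite /gmom !fctE.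
rewrite E; apply: is_derive_eq.
by rewrite !fctE /GRing.scale /= mulr1 /gmom !exprS; ring.
Qed.

Lemma continuous_gmom k : continuous (gmom k).
Proof.
move=> x; apply: cvgM; first exact: exprn_continuous.
by apply: continuous_normal_pdf; rewrite oner_neq0.
Qed.

Lemma gmom_ge0 k (x : R) : 0 <= x -> 0 <= gmom k x.
Proof. by move=> x0; rewrite mulr_ge0 ?exprn_ge0 ?normal_pdf_ge0. Qed.

(** The exponential of [y] is at least [y ^ (k + 1) / (k + 1)!]. With [y = x ^ 2 / 2] and [x] at
    least 1 this bounds [gmom k x] by [C / x]. *)
Lemma cvg_gmom k : gmom k x @[x --> +oo] --> (0 : R).
Proof.
pose C := normal_peak (1 : R) * (2 ^+ k.+1 * k.+1`!%:R).
apply: (squeeze_cvgr (f := fun=> 0) (h := fun x : R => C * x^-1)).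
- near=> x.
  have x1 : 1 <= x by near: x; apply: nbhs_pinfty_ge; exact: num_real.
  have x0 : 0 < x by apply: lt_le_trans x1.
  rewrite gmom_ge0 ?(ltW x0)//= /gmom phiE /C -mulrA mulrCA.
  apply: ler_wpM2l; first exact: normal_peak_ge0.
  have y0 : 0 <= x ^+ 2 / 2 by rewrite divr_ge0 ?exprn_ge0 // ltW.
  have := expR_ge1Dxn k y0; set e := expR _ => ebig.
  have e0 : 0 < e by exact: expR_gt0.
  rewrite mulNr expRN -/e ler_pdivrMr //.
  have step : x ^+ k.+1 <= 2 ^+ k.+1 * k.+1`!%:R * e.
    have h : (x ^+ 2 / 2) ^+ k.+1 / k.+1`!%:R <= e by apply: le_trans ebig; rewrite lerDr.
    rewrite ler_pdivrMr ?ltr0n ?fact_gt0// exprMn exprVn ler_pdivrMr ?exprn_gt0// in h.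
    apply: le_trans (_ : _ <= (x ^+ 2) ^+ k.+1) _.
      by rewrite -exprM; apply: ler_weXn2l => //; rewrite mul2n -addnn leq_addr.
    by apply: le_trans h _; rewrite le_eqVlt; apply/orP; left; apply/eqP; ring.
  rewrite mulrAC ler_pdivlMr // -exprSr; exact: step.
- exact: cvg_cst.
- rewrite -[X in _ --> X](mulr0 C); apply: cvgM; first exact: cvg_cst.
  apply/(gtr0_cvgV0 (f := @id R)); first by near=> x; near: x; apply: nbhs_pinfty_gt; exact: num_real.
  exact: cvg_id.
Unshelve. all: by end_near.
Qed.

End GaussianRecursion.

(** * Recursion and values of the Gaussian moments *)

Section GaussianMoment.
Context {R : realType}.
Local Open Scope classical_set_scope.
Local Open Scope ring_scope.
Local Notation mu := (@lebesgue_measure R).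

Lemma measurable_gmom k (D : set R) : measurable_fun D (fun x => (gmom k x)%:E).
Proof.
apply/measurable_EFinP; apply: measurable_funTS.
by apply: continuous_measurable_fun; exact: continuous_gmom.
Qed.

Lemma derive1_gmom k (x : R) :
  derive1 (gmom k.+1) x = k.+1%:R * gmom k x - gmom k.+2 x.
Proof. by rewrite derive1E; have h := is_derive_gmom k x; exact: derive_val. Qed.

Definition gdiff k (x : R) := k.+1%:R * gmom k x - gmom k.+2 x.

Lemma continuous_gdiff k : continuous (gdiff k).
Proof.
move=> x; apply: cvgB; last exact: continuous_gmom.
by apply: cvgM; [exact: cvg_cst|exact: continuous_gmom].
Qed.

Lemma gdiffE k (x : R) : gdiff k x = (k.+1%:R - x ^+ 2) * gmom k x.
Proof. by rewrite /gdiff /gmom !exprS; ring. Qed.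

Lemma ge0_integral_split (f : R -> R) (c : R) : (0 <= c)%R ->
  measurable_fun [set: R] (EFin \o f) -> (forall x, 0 <= x -> 0 <= f x)%R ->
  (\int[mu]_(x in `[0%R, +oo[) (f x)%:E =
   \int[mu]_(x in `[0%R, c]) (f x)%:E + \int[mu]_(x in `[c, +oo[) (f x)%:E)%E.
Proof.
move=> c0 mf f0; rewrite -(integral_itv_obnd_cbnd (r := c)); last exact: measurable_funTS.
rewrite -ge0_integral_setU//=.
- by rewrite -itv_bndbnd_setU.
- exact: measurable_funTS.
- move=> x; rewrite lee_fin => -[] /=; rewrite in_itv/= => /andP[h _]; apply: f0 => //.
  by apply: le_trans c0 (ltW h).
- apply/disj_setPS => x [] /=; rewrite !in_itv/= andbT => /andP[_ h1] h2.
  by move: h1; rewrite leNgt h2.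
Qed.

(** The derivative [gdiff k] of [gmom k.+1] changes sign at [c], the square root of k + 1. On both
    sides of [c] the fundamental theorem gives the same boundary value [gmom k.+1 c], because
    [gmom k.+1] vanishes at 0 and at infinity. Cutting at [c] keeps all integrands nonnegative, so
    no extended reals are subtracted. *)
Lemma integral_gmom_rec k :
  (\int[mu]_(x in `[0%R, +oo[) (gmom k.+2 x)%:E =
   k.+1%:R%:E * \int[mu]_(x in `[0%R, +oo[) (gmom k x)%:E)%E.
Proof.
pose c : R := Num.sqrt k.+1%:R.
have c0 : 0 < c by rewrite sqrtr_gt0.
have c2 : c ^+ 2 = k.+1%:R by rewrite sqr_sqrtr.
have lt_c x : 0 <= x -> (x <= c) -> 0 <= gdiff k x.
  move=> x0 xc; rewrite gdiffE mulr_ge0 ?gmom_ge0// subr_ge0 -c2.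
  by rewrite lerXn2r ?nnegrE// ltW.
have gt_c x : c <= x -> 0 <= - gdiff k x.
  move=> cx; have x0 : 0 <= x by apply: le_trans cx; exact: ltW.
  rewrite gdiffE -mulNr opprB mulr_ge0 ?gmom_ge0// subr_ge0 -c2.
  by rewrite lerXn2r ?nnegrE// ltW.
have mg j D : measurable_fun D (fun x : R => (gmom j x)%:E) by exact: measurable_gmom.
have md D : measurable_fun D (gdiff k).
  by apply: measurable_funTS; apply: continuous_measurable_fun; exact: continuous_gdiff.
have cg j (x : R) : {for x, continuous (gmom j)} by exact: continuous_gmom.
have below : (\int[mu]_(x in `[0%R, c]) (gdiff k x)%:E = (gmom k.+1 c)%:E)%E.
  rewrite (@continuous_FTC2 _ _ (gmom k.+1))//.
  - by rewrite [gmom k.+1 0]/gmom exprS !mul0r sube0.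
  - by apply: continuous_subspaceT; exact: continuous_gdiff.
  - split.
    + by move=> x _; have h := is_derive_gmom k x; exact: ex_derive.
    + exact/cvg_at_right_filter/cg.
    + exact/cvg_at_left_filter/cg.
  - by move=> x _; exact: derive1_gmom.
have above : (\int[mu]_(x in `[c, +oo[) (- gdiff k x)%:E = (gmom k.+1 c)%:E)%E.
  rewrite (@ge0_continuous_FTC2y _ _ (fun x => - gmom k.+1 x) c 0)//.
  - by rewrite EFinN oppeK add0e.
  - by apply: continuous_subspaceT => x; apply: cvgN; exact: continuous_gdiff.
  - by rewrite -oppr0; apply: cvgN; exact: cvg_gmom.
  - by move=> x _; have h := is_derive_gmom k x; exact: ex_derive.
  - by apply: cvg_at_right_filter; apply: cvgN; exact: cg.
  - move=> x _; have h := is_derive_gmom k x.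
    by rewrite derive1E; exact: derive_val.
have n1 : (0 <= k.+1%:R%:E :> \bar R)%E by rewrite lee_fin.
have eq1 : (k.+1%:R%:E * \int[mu]_(x in `[0%R, c]) (gmom k x)%:E =
    \int[mu]_(x in `[0%R, c]) (gmom k.+2 x)%:E + (gmom k.+1 c)%:E)%E.
  rewrite -below -ge0_integralD//=; last 4 first.
  - by move=> x; rewrite in_itv/= => /andP[x0 _]; rewrite lee_fin gmom_ge0.
  - exact: mg.
  - by move=> x; rewrite in_itv/= => /andP[x0 xc]; rewrite lee_fin lt_c.
  - by apply/measurable_EFinP; exact: md.
  rewrite -ge0_integralZl//=; last 2 first.
  - exact: mg.
  - by move=> x; rewrite in_itv/= => /andP[x0 _]; rewrite lee_fin gmom_ge0.
  by apply: eq_integral => x _; rewrite -EFinM -EFinD /gdiff addrC subrK.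
have eq2 : (\int[mu]_(x in `[c, +oo[) (gmom k.+2 x)%:E =
    k.+1%:R%:E * \int[mu]_(x in `[c, +oo[) (gmom k x)%:E + (gmom k.+1 c)%:E)%E.
  have x0 x : x \in `[c, +oo[ -> 0 <= x.
    by rewrite in_itv/= andbT; apply: le_trans; exact: ltW.
  rewrite -above -ge0_integralZl//=; last 2 first.
  - exact: mg.
  - by move=> x /x0 ?; rewrite lee_fin gmom_ge0.
  rewrite -ge0_integralD//=.
  - by apply: eq_integral => x _; rewrite -EFinM -EFinD /gdiff opprB addrC subrK.
  - by move=> x /x0 ?; rewrite -EFinM lee_fin mulr_ge0// gmom_ge0.
  - by apply: measurable_funeM; exact: mg.
  - by move=> x; rewrite in_itv/= andbT => /gt_c; rewrite lee_fin.
  - by apply/measurable_EFinP; apply: measurableT_comp => //; exact: md.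
rewrite (ge0_integral_split (ltW c0))//; [|exact: mg|exact: gmom_ge0].
rewrite [in RHS](ge0_integral_split (ltW c0))//; [|exact: mg|exact: gmom_ge0].
rewrite ge0_muleDr; last 2 first.
- by apply: integral_ge0 => x /=; rewrite in_itv/= => /andP[? _]; rewrite lee_fin gmom_ge0.
- apply: integral_ge0 => x /=; rewrite in_itv/= andbT => cx; rewrite lee_fin gmom_ge0//.
  by apply: le_trans cx; exact: ltW.
by rewrite eq1 eq2 [X in (_ + X = _)%E]addeC addeA.
Qed.

Lemma integralT_gmom m :
  (\int[mu]_x (gmom (2 * m) x)%:E = (odd_fact m)%:R%:E)%E.
Proof.
have half j : (\int[mu]_x (gmom (2 * j) x)%:E =
    2%:E * \int[mu]_(x in `[0%R, +oo[) (gmom (2 * j) x)%:E)%E.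
  rewrite ge0_symfun_integralT ?set_itvcy//.
  - by move=> x; rewrite mulr_ge0 ?normal_pdf_ge0// exprM exprn_ge0// sqr_ge0.
  - exact: continuous_gmom.
  - by move=> x; rewrite /gmom /= !phiE !exprM !sqrrN.
elim: m => [|m IH].
  rewrite /odd_fact big_ord0 -(integral_normal_pdf 0 (1 : R)).
  by apply: eq_integral => x _; rewrite /gmom muln0 expr0 mul1r.
rewrite /odd_fact big_ord_recr /= -/(odd_fact m) natrM EFinM -IH !half.
rewrite (_ : 2 * m.+1 = (2 * m).+2)%N; last by lia.
by rewrite integral_gmom_rec -muleA; congr (_ * _)%E; rewrite muleC.
Qed.

Lemma standard_normal_moment d (T : measurableType d) (Q : probability T R)
    (N : {RV Q >-> R}) m :
  (forall A : set R, measurable A -> distribution Q N A = normal_prob 0 1 A) ->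
  ('E_Q[(fun t => N t ^+ (2 * m))%R] = (odd_fact m)%:R%:E)%E.
Proof.
move=> HN; rewrite unlock.
pose f (x : measurableTypeR R) : \bar R := ((x : R) ^+ (2 * m))%:E.
have mf : measurable_fun setT f by apply/measurable_EFinP; apply: measurable_funX.
have f0 x : (0 <= f x)%E by rewrite lee_fin exprM exprn_ge0// sqr_ge0.
(* [R] carries a second, propositionally equal, measurable structure in the
   library: the Lebesgue integral is taken over [measurableTypeR R]. *)
have mN : measurable_fun [set: T] (N : T -> measurableTypeR R).
  exact: (measurable_funP N).
pose X : {RV Q >-> measurableTypeR R} :=
  MeasurableFun.Pack (MeasurableFun.Class (isMeasurableFun.Build _ _ _ _ _ mN)).
have := ge0_integral_distribution X mf f0; rewrite /comp => <-.
transitivity (\int[normal_prob (0 : R) 1]_x f x)%E.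
  by apply: eq_measure_integral => A mA _; exact: HN.
rewrite integral_normal_prob// -integralT_gmom.
by apply: eq_integral => x _; rewrite -EFinM.
Qed.

End GaussianMoment.

(** * Standardised moments *)

Section UniformPairPartition.
Context {R : realType}.
Local Open Scope classical_set_scope.
Local Open Scope ring_scope.

(** [f (H t)] is a finite combination of indicators of the fibres of [H]. Measurability is given for
    fibres over pair partitions; the other fibres are empty. *)
Lemma expectation_uniform d (T : measurableType d) (P : probability T R) n
    (H : T -> {set {set 'I_(2 * n)}}) (f : {set {set 'I_(2 * n)}} -> R) :
  uniform_pair_partition P H ->
  ('E_P[(fun t => f (H t))] = (mean (fun s => f (matching s)))%:E)%E.
Proof.
case=> Hpp HP; rewrite unlock mean_matching.
transitivity (\int[P]_t (\sum_(p | pair_partition p)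
    (f p)%:E * (\1_(H @^-1` [set p]) t)%:E))%E.
  apply: eq_integral => t _; rewrite (bigD1 (H t)) //= big1 ?adde0 => [|p /andP[_ pH]].
    by rewrite indicE mem_set // mule1.
  rewrite indicE memNset ?mule0 // => /= Hp.
  by rewrite Hp eqxx in pH.
rewrite integral_sum //=; last first.
  move=> p; have [pp|npp] := boolP (pair_partition p).
    by apply: integrableZl => //; apply: integrable_indic => //; case: (HP p pp).
  rewrite (_ : H @^-1` [set p] = set0); last first.
    by apply/seteqP; split => t //= Ht; move: (Hpp t); rewrite Ht (negbTE npp).
  by apply: integrableZl => //; exact: integrable_indic.
rewrite mulr_suml -sumEFin; apply: eq_bigr => p pp.
have [mp Pp] := HP p pp.
rewrite integralZl //; last exact: integrable_indic.
rewrite integral_indic // setIT; exact: (congr1 (mule (f p)%:E) Pp).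
Qed.

Lemma mean_total_dev n : mean (fun s : {perm 'I_n * bool} => total_dev R s) = 0.
Proof. by rewrite /total_dev mean_sum big1 // => e _; rewrite mean_dev. Qed.

Lemma crossings_centred n (s : {perm 'I_n * bool}) :
  (crossings (matching s))%:R - mean (fun t : {perm 'I_n * bool} => (crossings (matching t))%:R)
  = total_dev R s / 2.
Proof.
have [c Wc] := @total_dev_matching n R.
have := mean_total_dev n; rewrite (eq_mean Wc) meanB meanZ mean_cst.
move=> /eqP; rewrite subr_eq0 => /eqP cE; rewrite Wc -cE; move: (mean _) => x.
by field.
Qed.

(** The centred number of crossings is [total_dev / 2] and its variance is [sigma2 / 4], so the
    factors cancel; the even power removes the square root. *)
Lemma standardized_moment d (T : measurableType d) (P : probability T R) n
    (H : T -> {set {set 'I_(2 * n)}}) m :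
  uniform_pair_partition P H ->
  ('E_P[(fun t => standardize P (fun u => (crossings (H u))%:R) t ^+ (2 * m))%R] =
   (mean (fun s : {perm 'I_n * bool} => total_dev R s ^+ (2 * m)) / sigma2 R 'I_n ^+ m)%:E)%E.
Proof.
move=> unif; pose Y (p : {set {set 'I_(2 * n)}}) : R := (crossings p)%:R.
pose mY := mean (fun s => Y (matching s)).
have EY : fine 'E_P[fun t => Y (H t)]%E = mY by rewrite (expectation_uniform Y unif).
have VY : fine 'V_P[fun t => Y (H t)]%E = sigma2 R 'I_n / 4.
  rewrite /variance unlock EY.
  rewrite (_ : ((fun t => Y (H t)) \- cst mY)%R * _ = (fun t => (fun p => (Y p - mY) ^+ 2) (H t))).
    rewrite (expectation_uniform (fun p => (Y p - mY) ^+ 2) unif) /= /sigma2.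
    rewrite mulrC -meanZ; apply: eq_mean => s; rewrite crossings_centred.
    by field.
  by apply/funext => t; rewrite /= expr2.
pose f p := ((Y p - mY) / Num.sqrt (sigma2 R 'I_n / 4)) ^+ (2 * m).
rewrite (_ : (fun t => _) = (fun t => f (H t))); last first.
  by apply/funext => t; rewrite /standardize EY VY.
rewrite (expectation_uniform f unif); congr (_%:E).
rewrite mulrC -meanZ; apply: eq_mean => s.
have s4 : 0 <= sigma2 R 'I_n / 4.
  by apply: divr_ge0 => //; apply: mean_ge0 => t; rewrite sqr_ge0.
rewrite /f crossings_centred !exprM expr_div_n sqr_sqrtr //.
rewrite -exprVn -exprMn; congr (_ ^+ m).
by rewrite expr_div_n invf_div; move: (sigma2 R 'I_n)^-1 => v; field.
Qed.

End UniformPairPartition.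

Local Open Scope classical_set_scope.
Local Open Scope ring_scope.

Theorem mainTheorem9 (R : realType) (k : nat) (k_even : ~~ odd k) :
  exists C1 : R,
    forall n : nat, (2 <= n)%N ->
    forall (d : measure_display) (T : measurableType d) (P : probability T R)
      (H : T -> {set {set 'I_(2 * n)}}),
      uniform_pair_partition P H ->
    forall (d' : measure_display) (T' : measurableType d')
      (Q : probability T' R) (N : {RV Q >-> R}),
      standard_normal N ->
    let Y : T -> R := fun t => (crossings (H t))%:R in
    let Z : T -> R := standardize P Y in
    (`| 'E_P[(fun t => Z t ^+ k)%R] - 'E_Q[(fun t => N t ^+ k)%R] |
       <= (C1 * (1 / n%:R))%:E)%E.
Proof.
have -> : k = (2 * k./2)%N by rewrite mul2n even_halfK.
have [C HC] := even_moment_rate R k./2.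
exists C => n n2 d T P H unif d' T' Q N HN; cbv zeta.
rewrite (standardized_moment _ unif) (standard_normal_moment _ HN) -EFinB abse_EFin lee_fin div1r.
by have := HC 'I_n; rewrite card_ord; apply.
Qed.
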